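(* Let $\Gamma$ be a closed, countable, discrete subgroup of a second countable, locally compact abelian Hausdorff group $G$, admitting an injective endomorphism $\alpha:\Gamma\to\Gamma$ with $\Gamma/\alpha(\Gamma)$ finite of order $N>1$ and with dual endomorphism $\alpha^\ast(\chi)=\chi\circ\alpha$ ergodic for the normalized Haar measure $\lambda$ on $\widehat\Gamma$. Let $\mathcal H$ be a separable Hilbert space and $\pi:\Gamma\to\mathcal U(\mathcal H)$ a unitary representation with spectral data $(\mu,(\sigma_i)_i,T)$ such that $\mu\ll\lambda$. Then to every $\pi$-invariant closed subspace $V\subset\mathcal H$ there corresponds a $\mu$-measurable range function $J_V:\widehat\Gamma\to\{\text{closed subspaces of }\ell^2(\Gamma)\}$ such that $$V=\{f\in\mathcal H:\ Tf(\chi)\in J_V(\chi)\ \text{ for } \mu\text{-a.e. }\chi\in\widehat\Gamma\},$$ and the correspondence between $V$ and $J_V$ is one-to-one (range functions equal $\mu$-a.e. being identified). Moreover, there is an at most countable set $\mathscr A\subset\mathcal H$ with $$V=\overline{\operatorname{span}}\{\pi(\gamma)\varphi:\ \gamma\in\Gamma,\ \varphi\in\mathscr A\},$$ and for any at most countable set $\mathscr A\subset\mathcal H$ satisfying this equality one has $$J_V(\chi)=\overline{\operatorname{span}}\{T\varphi(\chi):\ \varphi\in\mathscr A\}\quad\text{for }\mu\text{-a.e. }\chi\in\widehat\Gamma .$$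
   Context: A closed subspace $V\subset\mathcal H$ is $\pi$-invariant if $\pi(\gamma)V\subset V$ for all $\gamma\in\Gamma$. Spectral data of a unitary representation $\pi$ of $\Gamma$ on a separable Hilbert space $\mathcal H$: a finite Borel measure $\mu$ on $\widehat\Gamma$ (unique up to equivalence), nested Borel sets $\cdots\subset\sigma_2\subset\sigma_1\subset\widehat\Gamma$ (unique up to $\mu$-null sets), and a unitary operator $T:\mathcal H\to\bigoplus_i L^2(\sigma_i,\mu)$ with $[T(\pi(\gamma)f)]_i(\chi)=(\gamma,\chi)[Tf]_i(\chi)$ for all $i$, $\gamma\in\Gamma$, $f\in\mathcal H$, $\mu$-a.e. $\chi$, where $(\gamma,\chi)$ is the value of $\chi$ at $\gamma$, and intertwining the projection valued measure of $\pi$ with multiplication by indicator functions of Borel sets. Here $L^2(\sigma_i,\mu)$ means the $\mu$-square integrable scalar functions on $\widehat\Gamma$ supported in $\sigma_i$. When $\mu\ll\lambda$ one takes $\mu$ to be the restriction of $\lambda$ to $\sigma_1$. Since $\Gamma$ is countably infinite, an enumeration of $\Gamma$ is fixed and $\bigoplus_i L^2(\sigma_i,\mu)$ is regarded as a subspace of $L^2(\widehat\Gamma,\ell^2(\Gamma),\mu)$, the Hilbert space of (classes of) measurable functions $F:\widehat\Gamma\to\ell^2(\Gamma)$ with $\int\|F(\chi)\|^2\,d\mu(\chi)<\infty$; thus $Tf(\chi)\in\ell^2(\Gamma)$ has coordinates $[Tf]_i(\chi)$. A range function is any map $J:\widehat\Gamma\to\{\text{closed subspaces of }\ell^2(\Gamma)\}$;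 it is $\mu$-measurable if for all $a,b\in\ell^2(\Gamma)$ the map $\chi\mapsto(P(\chi)a,b)$ is $\mu$-measurable, where $P(\chi)$ is the orthogonal projection of $\ell^2(\Gamma)$ onto $J(\chi)$. *)

(* Defs.v *)
From HB Require Import structures.
From mathcomp Require Import all_boot all_order all_algebra.
From mathcomp Require Import sesquilinear complex ring lra.
From mathcomp Require Import all_classical all_reals all_analysis measurable_realfun.

Set Implicit Arguments.
Unset Strict Implicit.
Unset Printing Implicit Defensive.
Import Order.TTheory GRing.Theory Num.Theory.
Import numFieldNormedType.Exports.
Import ComplexField.Normc.

Local Open Scope classical_set_scope.
Local Open Scope complex_scope.
Local Open Scope ring_scope.

Section EsumScale.
Context {R : realType} {I : choiceType}.
Implicit Types (c : R) (f : I -> R).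

Let esumZ_le c f : 0 <= c -> (forall i, 0 <= f i) ->
  (\esum_(i in [set: I]) (c * f i)%:E <= c%:E * \esum_(i in [set: I]) (f i)%:E)%E.
Proof.
move=> c0 f0; apply: ge_ereal_sup => _ [A [finA _] <-].
under eq_fsbigr do rewrite EFinM.
rewrite -ge0_mule_fsumr; last by move=> i; rewrite lee_fin.
by apply: lee_wpmul2l => //; apply: ereal_sup_ubound; exists A.
Qed.

Lemma esumZ c f : 0 <= c -> (forall i, 0 <= f i) ->
  (\esum_(i in [set: I]) (c * f i)%:E = c%:E * \esum_(i in [set: I]) (f i)%:E)%E.
Proof.
move=> c0 f0; apply/eqP; rewrite eq_le esumZ_le//=.
have [c1|c1] := eqVneq c 0; [rewrite c1|have {}c0 : 0 < c by rewrite lt0r c1].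
  by rewrite mul0e; apply: esum_ge0 => i _; rewrite mul0r.
have cf0 i : 0 <= c * f i by rewrite mulr_ge0// ltW.
have ci0 : 0 <= c^-1 by rewrite invr_ge0 ltW.
have /(lee_wpmul2l (ltW c0 : (0 <= c%:E)%E)) := esumZ_le ci0 cf0.
rewrite muleA -EFinM divff ?gt_eqF// mul1e.
by under eq_esum do rewrite mulKf ?gt_eqF//.
Qed.

End EsumScale.

Section L2.
Variables (R : realType) (I : choiceType).
Local Notation C := R[i].

Definition sumsq (a : I -> C^o) : \bar R :=
  \esum_(g in [set: I]) (normc (a g) ^+ 2)%:E.

Definition l2_pred : {pred I -> C^o} := [pred a | (sumsq a < +oo)%E].

Lemma normc_ge0 (x : C) : 0 <= normc x.
Proof. by case: x => u v; exact: sqrtr_ge0. Qed.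

Lemma sumsq_ge0 a : (0 <= sumsq a)%E.
Proof. by apply: esum_ge0 => g _; rewrite lee_fin sqr_ge0. Qed.

Lemma sumsqZ (c : C) (a : I -> C^o) : sumsq (c *: a) = ((normc c ^+ 2)%:E * sumsq a)%E.
Proof.
rewrite /sumsq -esumZ ?sqr_ge0//; last by move=> g; rewrite sqr_ge0.
by apply: eq_esum => g _; rewrite /= /GRing.scale/= normcM exprMn.
Qed.

Lemma sumsqD t (a b : I -> C^o) : 0 < t ->
  (sumsq (a + b)%R <= (1 + t)%:E * sumsq a + (1 + t^-1)%:E * sumsq b)%E.
Proof.
move=> t0; have ti0 : 0 < t^-1 by rewrite invr_gt0.
rewrite /sumsq -!esumZ; [|lra|by move=> g; rewrite sqr_ge0
                         |lra|by move=> g; rewrite sqr_ge0].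
rewrite -esumD; first apply: le_esum.
- move=> g _; rewrite -EFinD lee_fin.
  set x := normc (a g); set y := normc (b g).
  have xy : normc ((a + b) g) <= x + y by exact: le_normcD.
  have xy2 : normc ((a + b) g) ^+ 2 <= (x + y) ^+ 2.
    by rewrite ler_sqr// nnegrE ?addr_ge0 ?normc_ge0.
  apply: (le_trans xy2).
  have : 0 <= t^-1 * (t * x - y) ^+ 2 by rewrite mulr_ge0 ?sqr_ge0 ?ltW.
  have -> : t^-1 * (t * x - y) ^+ 2 = t * x ^+ 2 - 2 * x * y + t^-1 * y ^+ 2.
    by field; rewrite gt_eqF.
  by lra.
- by move=> g _; rewrite lee_fin mulr_ge0 ?sqr_ge0//; lra.
- by move=> g _; rewrite lee_fin mulr_ge0 ?sqr_ge0//; lra.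
Qed.

Fact l2_submod : submod_closed l2_pred.
Proof.
split=> [|c a b]; rewrite !inE.
  rewrite /sumsq esum1 ?ltry// => g _.
  by rewrite -[X in normc X]/(0%:C : C) normc0 expr0n.
move=> a2 b2; apply: le_lt_trans (sumsqD _ _ ltr01) _.
by rewrite lte_add_pinfty// ?sumsqZ; rewrite ?lte_mul_pinfty ?mule_ge0 ?lee_fin
  ?addr_ge0 ?invr_ge0 ?sqr_ge0 ?sumsq_ge0.
Qed.
HB.instance Definition _ :=
  GRing.isSubmodClosed.Build C (I -> C^o) l2_pred l2_submod.

Record l2 := L2 { l2_val :> I -> C^o; _ : l2_val \in l2_pred }.
HB.instance Definition _ := [isSub for l2_val].
HB.instance Definition _ := [Choice of l2 by <:].
HB.instance Definition _ := [SubChoice_isSubLmodule of l2 by <:].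

Definition l2_norm (a : l2) : R := Num.sqrt (fine (sumsq a)).

Lemma l2_norm_ge0 a : 0 <= l2_norm a.
Proof. exact: sqrtr_ge0. Qed.

Lemma sumsqE (a : l2) : sumsq a = (l2_norm a ^+ 2)%:E.
Proof.
have a2 : (sumsq a < +oo)%E by case: a.
rewrite sqr_sqrtr ?fine_ge0 ?sumsq_ge0// fineK//.
by rewrite ge0_fin_numE ?sumsq_ge0.
Qed.

Fact ler_l2_normD a b : (l2_norm (a + b))%:C <= (l2_norm a)%:C + (l2_norm b)%:C.
Proof.
rewrite -rmorphD/= lecR; apply/ler_addgt0Pr => e e0.
have a0 := l2_norm_ge0 a; have b0 := l2_norm_ge0 b.
pose A := l2_norm a + e / 2; pose B := l2_norm b + e / 2.
have A0 : 0 < A by rewrite /A; lra.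
have B0 : 0 < B by rewrite /B; lra.
have -> : l2_norm a + l2_norm b + e = A + B by rewrite /A /B; field.
have AB0 : 0 <= A + B by rewrite addr_ge0 ?(ltW A0) ?(ltW B0).
rewrite -ler_sqr ?nnegrE ?l2_norm_ge0//.
have t0 : 0 < B / A by rewrite divr_gt0.
have := @sumsqD (B / A) a b t0.
rewrite (_ : (a : I -> C^o) + (b : I -> C^o) = (a + b : l2))//.
rewrite !sumsqE -!EFinM -EFinD lee_fin => /le_trans; apply.
have -> : (A + B) ^+ 2 = (1 + B / A) * A ^+ 2 + (1 + (B / A)^-1) * B ^+ 2.
  by field; rewrite !gt_eqF.
have ti0 : 0 <= (B / A)^-1 by rewrite invr_ge0 ltW.
apply: lerD; apply: ler_wpM2l; [lra| |lra|].
  by rewrite ler_sqr ?nnegrE ?(ltW A0)// /A; lra.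
by rewrite ler_sqr ?nnegrE ?(ltW B0)// /B; lra.
Qed.

Fact l2_normZ (c : C) a : (l2_norm (c *: a))%:C = `|c| * (l2_norm a)%:C.
Proof.
rewrite [`|c|](_ : _ = (normc c)%:C)// -rmorphM/=; congr (_%:C).
apply/eqP; rewrite -(@eqrXn2 _ 2)// ?mulr_ge0 ?normc_ge0 ?l2_norm_ge0//.
have := sumsqZ c a.
rewrite (_ : c *: (a : I -> C^o) = (c *: a : l2))// !sumsqE -EFinM => -[->].
by rewrite exprMn.
Qed.

Fact l2_norm0_eq0 a : (l2_norm a)%:C = 0 -> a = 0.
Proof.
move=> [] a0; apply/val_inj/funext => g /=; apply: eq0_normc.
have : ((normc (a g) ^+ 2)%:E <= sumsq a)%E.
  by apply: esum_ge; exists [set g]; rewrite ?fsbig_set1//; split.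
rewrite sumsqE a0 expr0n/= lee_fin => h.
by apply/eqP; rewrite -sqrf_eq0 eq_le h sqr_ge0.
Qed.

HB.instance Definition _ :=
  Lmodule_isNormed.Build C l2 ler_l2_normD l2_normZ l2_norm0_eq0.

HB.instance Definition _ := Measurable.copy l2 (g_sigma_algebraType (@open l2)).

(* sum of an absolutely summable family, as the difference of the sums of its
   positive and negative parts *)
Definition real_sum (f : I -> R) : R :=
  fine (\esum_(g in [set: I]) (Num.max (f g) 0)%:E) -
  fine (\esum_(g in [set: I]) (Num.max (- f g) 0)%:E).

Definition complex_sum (f : I -> C) : C :=
  real_sum (fun g => complex.Re (f g)) +i* real_sum (fun g => complex.Im (f g)).

Definition l2_dot (a b : l2) : C :=
  complex_sum (fun g => (a g : C) * Num.conj (b g : C)).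

End L2.

Section Subgroup.
Variables (G : zmodType) (S : zmodClosed G).

Record subgroup := Subgroup { subgroup_val :> G; _ : subgroup_val \in S }.
HB.instance Definition _ := [isSub for subgroup_val].
HB.instance Definition _ := [Choice of subgroup by <:].
HB.instance Definition _ := [SubChoice_isSubZmodule of subgroup by <:].

End Subgroup.

Section Dual.
Variables (R : realType) (Gamma : zmodType).
Local Notation C := R[i].

(* The group is discrete, so every homomorphism into the circle is continuous
   and the compact-open topology is that of pointwise convergence. *)
Record dual := Character {
  char_val :> Gamma -> C^o;
  char_norm : forall g, `|char_val g| = 1;
  charD : forall g h, char_val (g + h) = char_val g * char_val h
}.

Fact char1_norm (g : Gamma) : `|1 : C^o| = 1.
Proof. exact: normr1. Qed.
Fact char1D (g h : Gamma) : (1 : C^o) = 1 * 1.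
Proof. by rewrite mulr1. Qed.
Definition char1 := Character char1_norm char1D.

Section CharMul.
Variables chi psi : dual.
Fact char_mul_norm g : `|chi g * psi g| = 1.
Proof. by rewrite normrM !char_norm mulr1. Qed.
Fact char_mulD g h :
  chi (g + h) * psi (g + h) = (chi g * psi g) * (chi h * psi h).
Proof. by rewrite !charD mulrACA. Qed.
Definition char_mul := Character char_mul_norm char_mulD.
End CharMul.

Section DualEndo.
Variables (alpha : {additive Gamma -> Gamma}) (chi : dual).
Fact dual_endo_norm g : `|chi (alpha g)| = 1.
Proof. exact: char_norm. Qed.
Fact dual_endoD g h : chi (alpha (g + h)) = chi (alpha g) * chi (alpha h).
Proof. by rewrite raddfD charD. Qed.
Definition dual_endo := Character dual_endo_norm dual_endoD.
End DualEndo.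

HB.instance Definition _ := gen_eqMixin dual.
HB.instance Definition _ := gen_choiceMixin dual.
HB.instance Definition _ := isPointed.Build dual char1.
HB.instance Definition _ := Topological.copy dual
  (initial_topology (char_val : dual -> {ptws Gamma -> C^o})).
HB.instance Definition _ :=
  Measurable.copy dual (g_sigma_algebraType (@open dual)).

(* For countable [Gamma] the dual is compact and metrizable, so that a finite
   Borel measure on it is automatically regular. *)
Definition is_haar (lambda : probability dual R) :=
  forall (psi : dual) (E : set dual), measurable E ->
    lambda (char_mul psi @` E) = lambda E.

Definition ergodic (lambda : probability dual R) (f : dual -> dual) :=
  [/\ measurable_fun setT f,
      forall E, measurable E -> lambda (f @^-1` E) = lambda E &
      forall E, measurable E -> f @^-1` E = E ->
        lambda E = 0%E \/ lambda E = 1%E].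

Definition complex_integral (m : {measure set dual -> \bar R})
    (f : dual -> C) : C :=
  (\int[m]_chi complex.Re (f chi)) +i* (\int[m]_chi complex.Im (f chi)).

End Dual.

Section Hilbert.
Variables (R : realType).
Local Notation C := R[i].

Definition separable (T : topologicalType) :=
  exists2 D : set T, countable D & dense D.

(* The norm of a normed module over [R[i]] takes its values in [R[i]]. *)
Definition rnorm (E : normedModType C) (x : E) : R := complex.Re `|x|.

Definition lin_span (E : lmodType C) (A : set E) : set E :=
  [set x | exists (n : nat) (c : 'I_n -> C) (a : 'I_n -> E),
     (forall i, A (a i)) /\ x = \sum_i c i *: a i].

Definition closed_span (E : normedModType C) (A : set E) : set E :=
  closure (lin_span A).

Definition closed_subspace (E : normedModType C) (M : set E) :=
  [/\ M 0, (forall (c : C) x y, M x -> M y -> M (c *: x + y)) & closed M].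

Definition orth_proj (E : normedModType C) (dot : E -> E -> C) (M : set E)
    (x : E) : E :=
  get [set y | M y /\ forall z, M z -> dot (x - y) z = 0].

End Hilbert.

Section Representation.
Variables (R : realType) (Gamma : zmodType).
Variables (H : completeNormedModType R[i]) (dot : {dot H for @Num.conj R[i]}).
Local Notation C := R[i].
Local Notation dual := (dual R Gamma).
Implicit Types pi : Gamma -> {linear H -> H}.

Definition unitary_rep pi :=
  [/\ forall x, pi 0 x = x,
      forall g h x, pi (g + h) x = pi g (pi h x) &
      forall g x y, dot (pi g x) (pi g y) = dot x y].

Definition invariant_subspace pi (V : set H) :=
  closed_subspace V /\ forall g x, V x -> V (pi g x).

Record spectral_measure (p : set dual -> {linear H -> H}) : Prop := {
  spectral_measure_sym : forall E, measurable E ->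
    forall x y, dot (p E x) y = dot x (p E y);
  spectral_measureT : forall x, p setT x = x;
  spectral_measureI : forall E F, measurable E -> measurable F ->
    forall x, p (E `&` F) x = p E (p F x);
  spectral_measure_sigma_additive : forall F : nat -> set dual,
    (forall n, measurable (F n)) -> trivIset setT F ->
    forall x, (\sum_(k < n) p (F k) x) @[n --> \oo] --> p (\bigcup_n F n) x
}.

(* [pi g] is the integral of [chi g] against [p]; by polarization it is enough
   to say so for the measures [E |-> dot (p E x) x]. *)
Definition spectral_measure_of pi (p : set dual -> {linear H -> H}) :=
  spectral_measure p /\
  forall x, exists m : {finite_measure set dual -> \bar R},
    (forall E, measurable E -> m E = (complex.Re (dot (p E x) x))%:E) /\
    (forall g, dot (pi g x) x = complex_integral m (fun chi => chi g)).

End Representation.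

Section SpectralData.
Variables (R : realType) (Gamma : zmodType).
Local Notation C := R[i].
Local Notation dual := (dual R Gamma).
Local Notation l2 := (l2 R Gamma).
Variables (mu : {finite_measure set dual -> \bar R}) (e : nat -> Gamma)
  (sigma : nat -> set dual).

Definition L2_vec (F : dual -> l2) :=
  measurable_fun setT F /\ (\int[mu]_chi (rnorm (F chi) ^+ 2)%:E < +oo)%E.

(* the coordinates that may be nonzero at [chi] in the direct sum of the
   [L^2(sigma i, mu)], the i-th summand being the coordinate [e i] *)
Definition fibre (chi : dual) : set l2 :=
  [set a | forall i, ~ sigma i chi -> a (e i) = 0].

Definition in_direct_sum (F : dual -> l2) :=
  L2_vec F /\ {ae mu, forall chi, fibre chi (F chi)}.

(* measurability for the completion of the Borel sigma-algebra *)
Definition mu_measurable (h : dual -> C) :=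
  forall U : set C^o, open U -> completed_algebra_gen mu (h @^-1` U).

Definition range_function (J : dual -> set l2) :=
  forall chi, closed_subspace (J chi).

Definition measurable_range_function (J : dual -> set l2) :=
  range_function J /\
  forall a b : l2,
    mu_measurable (fun chi => l2_dot (orth_proj (@l2_dot R Gamma) (J chi) a) b).

Variables (H : completeNormedModType C) (dot : {dot H for @Num.conj C}).

(* [T x] is a representative of an element of [L^2(dual, l2, mu)], so that the
   algebraic identities hold almost everywhere. *)
Record spectral_data (pi : Gamma -> {linear H -> H})
    (p : set dual -> {linear H -> H}) (T : H -> dual -> l2) : Prop := {
  spectral_data_measurable : forall i, measurable (sigma i);
  spectral_data_nested : forall i, sigma i.+1 `<=` sigma i;
  spectral_data_codom : forall x, in_direct_sum (T x);
  spectral_data_linear : forall (c : C) x y,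
    {ae mu, forall chi, T (c *: x + y) chi = c *: T x chi + T y chi};
  spectral_data_isometry : forall x,
    (\int[mu]_chi (rnorm (T x chi) ^+ 2)%:E = (rnorm x ^+ 2)%:E)%E;
  spectral_data_surj : forall F, in_direct_sum F ->
    exists x, {ae mu, forall chi, T x chi = F chi};
  spectral_data_rep : forall g x,
    {ae mu, forall chi, T (pi g x) chi = (chi g : C) *: T x chi};
  spectral_data_proj : forall E, measurable E -> forall x,
    {ae mu, forall chi, T (p E x) chi = (\1_E chi : C) *: T x chi}
}.

End SpectralData.

(* Main.v *)
Require Import Defs.
From mathcomp Require Import all_boot all_order all_algebra.
From mathcomp Require Import sesquilinear complex ring lra.
From mathcomp Require Import all_classical all_reals all_analysis measurable_realfun.
Import Order.TTheory GRing.Theory Num.Theory.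
Import numFieldNormedType.Exports.
Import ComplexField.Normc.

Set Implicit Arguments.
Unset Strict Implicit.
Unset Printing Implicit Defensive.

Local Open Scope classical_set_scope.
Local Open Scope complex_scope.
Local Open Scope ring_scope.

(** The functions f on the dual group such that V is stable under the operator
    that T turns into multiplication by f form an algebra.  It contains the
    evaluations chi |-> chi g and is closed under bounded pointwise limits
    (dominated convergence), hence it contains the indicators of all Borel sets:
    the sign function is a limit of polynomials, and the sets
    {|chi g - q| < r} generate the Borel sigma-algebra.

    Let (v n) be dense in V and let J chi be the closed span of the T (v n) chi.
    If T f chi lies in J chi almost everywhere, cut the dual group into Borel
    sets on which T f is close to one fixed rational combination of the T (v n);
    gluing these combinations with indicators gives elements of V close to f.
    Conversely, for any range function K the f with T f in K almost everywhere
    form a closed invariant subspace, and a measurable K inside the fibres is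
    spanned by its sections chi |-> P_K(chi) (delta n), which T attains.
    Measurability of J holds because the distance to J chi is a countable
    infimum and determines the projection by polarization. *)

(** * Complex normed modules *)

(** The obstacle is that gluing needs [V] to be stable under multiplication by indicators, while
    only the characters are known to preserve it. The sign is the bridge: it is a pointwise limit of
    polynomials that stay bounded by 1 on [-1, 1], and a bounded pointwise limit is all that
    dominated convergence asks for. Real polynomials in the characters are at hand because
    [chi (- g)] is the conjugate of [chi g], so the square of [|chi g - q|] is already in the
    algebra. A second constraint comes from [T x] being a mere representative: each identity fails
    on a null set that depends on the vectors involved, so every argument at a point [chi] is
    confined to countably many vectors. Hence the rational combinations, the dense sequences and the
    enumerations by [pickle]. *)

Section ComplexNormedModule.
Context {R : realType}.
Local Notation C := R[i].

Lemma normr_normc (c : C) : `|c| = (normc c)%:C.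
Proof. by case: c. Qed.

Lemma normc_real (r : R) : normc r%:C = `|r|.
Proof. by rewrite /normc/= expr0n/= addr0 sqrtr_sqr. Qed.

Lemma normc_sqr (c : C) : normc c ^+ 2 = complex.Re c ^+ 2 + complex.Im c ^+ 2.
Proof. by case: c => a b /=; rewrite sqr_sqrtr// addr_ge0 ?sqr_ge0. Qed.

Lemma normc_ltP (c : C) (r : R) : 0 < r ->
  (normc c < r) = (complex.Re c ^+ 2 + complex.Im c ^+ 2 < r ^+ 2).
Proof.
move=> r0; rewrite -normc_sqr ltr_pXn2r// nnegrE ?normc_ge0//.
exact: ltW.
Qed.

Lemma ler_Re_normc (c : C) : `|complex.Re c| <= normc c.
Proof.
by rewrite -(@ler_pXn2r _ 2)// ?nnegrE ?normc_ge0// normc_sqr real_normK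
  ?num_real// lerDl sqr_ge0.
Qed.

Lemma ler_Im_normc (c : C) : `|complex.Im c| <= normc c.
Proof.
by rewrite -(@ler_pXn2r _ 2)// ?nnegrE ?normc_ge0// normc_sqr real_normK
  ?num_real// lerDr sqr_ge0.
Qed.

Context {E : normedModType C}.
Implicit Types (x y z : E) (A M : set E) (c : C).

(** Nonnegativity in the order of [R[i]] forces the imaginary part of the norm to vanish, so real
    radii describe the whole topology. *)
Lemma rnormE x : `|x| = (rnorm x)%:C.
Proof.
have := normr_ge0 x; rewrite /rnorm; case: (`|x|) => a b.
by rewrite lecE/= => /andP[/eqP -> _].
Qed.

Lemma rnorm_ge0 x : 0 <= rnorm x.
Proof. by rewrite -ler0c -rnormE. Qed.

Lemma rnormD x y : rnorm (x + y) <= rnorm x + rnorm y.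
Proof. by rewrite -lecR rmorphD/= -!rnormE ler_normD. Qed.

Lemma rnormZ c x : rnorm (c *: x) = normc c * rnorm x.
Proof. by apply/complexI; rewrite rmorphM/= -!rnormE normrZ normr_normc. Qed.

Lemma rnormN x : rnorm (- x) = rnorm x.
Proof. by rewrite /rnorm normrN. Qed.

Lemma rnormB x y : rnorm (x - y) = rnorm (y - x).
Proof. by rewrite /rnorm distrC. Qed.

Lemma rnorm0 : rnorm (0 : E) = 0.
Proof. by rewrite /rnorm normr0. Qed.

Lemma rnorm0_eq0 x : rnorm x = 0 -> x = 0.
Proof. by move=> x0; apply/normr0_eq0; rewrite rnormE x0. Qed.

Lemma ler_rnormB x y z : rnorm (x - z) <= rnorm (x - y) + rnorm (y - z).
Proof. by rewrite (le_trans _ (rnormD _ _))// addrA subrK. Qed.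

Lemma nbhs_rnormP x A :
  nbhs x A <-> exists2 e : R, 0 < e & forall y, rnorm (x - y) < e -> A y.
Proof.
split=> [/nbhs_normP[e/= e0 eA]|[e e0 eA]].
  have eE : e = (complex.Re e)%:C by rewrite RRe_real// gtr0_real.
  exists (complex.Re e); first by rewrite -ltcR -eE.
  by move=> y xy; apply: eA => /=; rewrite rnormE eE ltcR.
apply/nbhs_normP; exists (e%:C) => /=; first by rewrite ltcR.
by move=> y /=; rewrite rnormE ltcR => /eA.
Qed.

Lemma closure_rnormP x A :
  closure A x <-> forall e : R, 0 < e -> exists2 y, A y & rnorm (x - y) < e.
Proof.
split=> [Ax e e0|Ax B /nbhs_rnormP[e e0 eB]].
  have [|y [Ay xy]] := Ax [set y | rnorm (x - y) < e]; last by exists y.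
  by apply/nbhs_rnormP; exists e.
by have [y Ay xy] := Ax _ e0; exists y; split=> //; exact: eB.
Qed.

Lemma open_lipschitz_gt (f : E -> R) (c : R) :
  (forall x y, `|f x - f y| <= rnorm (x - y)) -> open [set x | c < f x].
Proof.
move=> lf; rewrite openE => x /= cx; apply/nbhs_rnormP.
exists (f x - c) => [|y xy]; first by rewrite subr_gt0.
have := le_lt_trans (lf x y) xy.
by move=> /(le_lt_trans (ler_norm _)); rewrite ltrD2l ltrN2.
Qed.

Lemma closed_subspace_approx M x : closed_subspace M ->
  (forall e : R, 0 < e -> exists2 y, M y & rnorm (x - y) < e) -> M x.
Proof. by move=> [_ _ cM] Mx; apply: cM; exact/closure_rnormP. Qed.

Lemma closed_subspace_sum M (I : Type) (r : seq I) (P : pred I) (F : I -> E) :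
  closed_subspace M -> (forall i, M (F i)) -> M (\sum_(i <- r | P i) F i).
Proof.
move=> [M0 MD _] MF; elim/big_ind: _ => // x y Mx My.
by rewrite -[x]scale1r; exact: MD.
Qed.

Lemma closed_subspaceZ M c x : closed_subspace M -> M x -> M (c *: x).
Proof. by move=> [M0 MD _] Mx; rewrite -[_ *: _]addr0; exact: MD. Qed.

Lemma closed_subspaceB M x y : closed_subspace M -> M x -> M y -> M (x - y).
Proof. by move=> [M0 MD _] Mx My; rewrite addrC -scaleN1r; exact: MD. Qed.

Lemma lin_span_min A M : (forall c x y, M x -> M y -> M (c *: x + y)) -> M 0 ->
  A `<=` M -> lin_span A `<=` M.
Proof.
move=> MD M0 AM _ [n [c [a [Aa ->]]]].
elim/big_ind: _ => [//|x y Mx My|i _]; first by rewrite -[x]scale1r; exact: MD.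
by rewrite -[_ *: _]addr0; apply: MD => //; exact: AM.
Qed.

Lemma closed_span_min A M : closed_subspace M -> A `<=` M ->
  closed_span A `<=` M.
Proof.
move=> [M0 MD cM] AM; rewrite [X in _ `<=` X]((closure_id M).1 cM);
  apply: closureS.
exact: lin_span_min.
Qed.

Lemma sub_lin_span A : A `<=` lin_span A.
Proof.
move=> x Ax; exists 1%N, (fun=> 1), (fun=> x); split=> //.
by rewrite big_ord1 scale1r.
Qed.

Lemma sub_closed_span A : A `<=` closed_span A.
Proof. exact: subset_trans (@sub_lin_span A) (@subset_closure _ _). Qed.

Lemma lin_span_add A c x y : lin_span A x -> lin_span A y ->
  lin_span A (c *: x + y).
Proof.
move=> [n [d [a [Aa ->]]]] [m [d' [a' [Aa' ->]]]].
exists (n + m)%N,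
  (fun i : 'I_(n + m) =>
    match fintype.split i with inl j => c * d j | inr j => d' j end),
  (fun i : 'I_(n + m) =>
    match fintype.split i with inl j => a j | inr j => a' j end); split.
  by move=> i; case: fintype.split.
rewrite big_split_ord/= scaler_sumr; congr (_ + _).
  apply: eq_bigr => i _; rewrite scalerA.
  by rewrite -[lshift m i]/(unsplit (inl i)) unsplitK.
apply: eq_bigr => i _.
by rewrite -[rshift n i]/(unsplit (inr i)) unsplitK.
Qed.

Lemma closed_span_subspace A : closed_subspace (closed_span A).
Proof.
split; last exact: closed_closure.
  apply/subset_closure; exists 0%N, (fun=> 0), (fun=> 0).
  by split=> [[]//|]; rewrite big_ord0.
move=> c x y /closure_rnormP Ax /closure_rnormP Ay.
apply/closure_rnormP => e e0.
have c0 : 0 < normc c + 1 by rewrite ltr_wpDl// normc_ge0.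
have [x' Ax' xx'] := Ax _ (divr_gt0 (divr_gt0 e0 (@ltr0Sn _ 1)) c0).
have [y' Ay' yy'] := Ay _ (divr_gt0 e0 (@ltr0Sn _ 1)).
exists (c *: x' + y'); first exact: lin_span_add.
rewrite opprD addrACA -scalerBr (le_lt_trans (rnormD _ _))// rnormZ.
rewrite [ltRHS]splitr ler_ltD//.
move: xx'; rewrite ltr_pdivlMr// => /ltW; apply: le_trans.
by rewrite mulrC ler_wpM2l ?rnorm_ge0// lerDl.
Qed.

Definition cratr (q : rat * rat) : C := ratr q.1 +i* ratr q.2.

Lemma cratr_dense c (e : R) : 0 < e -> exists q, normc (c - cratr q) < e.
Proof.
move=> e0; have e2 : 0 < e / 2 by rewrite divr_gt0.
have lt_e (r : R) : exists q : rat, `|r - ratr q| < e / 2.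
  have [|q /[!in_itv]/=/andP[rq qr]] :=
    @rat_in_itvoo R (r - e / 2) (r + e / 2); first by lra.
  exists q; rewrite ltr_norml.
  by apply/andP; split; [move: qr|move: rq]; lra.
have [q1 q1P] := lt_e (complex.Re c); have [q2 q2P] := lt_e (complex.Im c).
exists (q1, q2); rewrite normc_ltP// /cratr; case: c q1P q2P => a b /= q1P q2P.
rewrite -[X in X + _]real_normK ?num_real// -[X in _ + X]real_normK ?num_real//.
set u := `|_|; set v := `|_|.
have u0 : 0 <= u := normr_ge0 _.
have v0 : 0 <= v := normr_ge0 _.
move: q1P q2P; rewrite -/u -/v => q1P q2P.
have sq w : 0 <= w -> w < e / 2 -> w ^+ 2 < e ^+ 2 / 4.
  move=> w0 we; have -> : e ^+ 2 / 4 = (e / 2) ^+ 2 by field.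
  by rewrite ltr_pXn2r// nnegrE// ltW.
have e20 : 0 < e ^+ 2 by rewrite exprn_gt0.
have := sq _ u0 q1P; have := sq _ v0 q2P; lra.
Qed.

(** Indexing by finite sequences of indices and rational coefficients makes the index a countable
    type, so [pickle] enumerates all combinations. *)
Definition qcomb (v : nat -> E) (s : seq (nat * (rat * rat))) : E :=
  \sum_(p <- s) cratr p.2 *: v p.1.

(** The coefficients of a combination are replaced one at a time by rational ones, at a cost as
    small as desired. Membership in a closed span thus becomes a condition on countably many
    vectors. *)
Lemma closed_span_range (v : nat -> E) :
  closed_span (range v) = closure (range (qcomb v)).
Proof.
apply/seteqP; split; last first.
  rewrite closureE; apply: smallest_sub; first exact: closed_closure.
  move=> _ [s _ <-]; have sM := closed_span_subspace (range v).
  by apply: (closed_subspace_sum _ _ sM) => -[k q];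
    apply: (closed_subspaceZ _ sM); apply: sub_closed_span; exists k.
rewrite /closed_span closureE; apply: smallest_sub; first exact: closed_closure.
move=> _ [n [c [a [va ->]]]].
elim: n c a va => [|n IH] c a va.
  by rewrite big_ord0; apply: subset_closure; exists [::] => //;
    rewrite /qcomb big_nil.
rewrite big_ord_recl; have /closure_rnormP IHn :=
  IH (c \o lift ord0) (a \o lift ord0)
  (fun i => va (lift ord0 i)).
apply/closure_rnormP => e e0; have e2 : 0 < e / 2 by rewrite divr_gt0.
have [_ [s _ <-] sP] := IHn _ e2; have [k _ ka] := va ord0.
(* The [+ 1] keeps the divisor positive when [v k] vanishes. *)
have k0 : 0 < rnorm (v k) + 1 by rewrite ltr_wpDl// rnorm_ge0.
have [q qP] := cratr_dense (c ord0) (divr_gt0 e2 k0).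
exists (qcomb v ((k, q) :: s)); first by exists ((k, q) :: s).
rewrite /qcomb big_cons/= -/(qcomb v s) -ka opprD addrACA -scalerBl.
rewrite (le_lt_trans (rnormD _ _))// [ltRHS]splitr ler_ltD// rnormZ.
move: qP; rewrite ltr_pdivlMr// => /ltW; apply: le_trans.
by rewrite ler_wpM2l ?normc_ge0// lerDl.
Qed.

(** An open set is the union of the countably many balls inside it that have a centre [D n] and a
    rational radius. A radius below [e / 2] keeps a ball through [h t] within distance [e] of
    [h t]. *)
Lemma measurable_preimage_open d (X : measurableType d) (D : nat -> E)
  (h : X -> E) :
  (forall x (e : R), 0 < e -> exists n, rnorm (x - D n) < e) ->
  (forall n (r : R), 0 < r -> measurable [set t | rnorm (h t - D n) < r]) ->
  forall U, open U -> measurable (h @^-1` U).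
Proof.
move=> dD mh U oU.
pose B (p : nat * rat) : set E := [set x | rnorm (x - D p.1) < ratr p.2].
have -> : h @^-1` U = \bigcup_p (if (0 < p.2) && `[< B p `<=` U >] then
    h @^-1` B p else set0).
  apply/seteqP; split=> [t Ut|t [p _]]; last first.
    by case: ifP => // /andP[_ /asboolP] BU /BU.
  have /nbhs_rnormP[e e0 eU] : nbhs (h t) U by rewrite nbhsE; exists U.
  have [|q /[!in_itv]/=/andP[q0 qe]] := @rat_in_itvoo R 0 (e / 2);
    first by rewrite divr_gt0.
  have [n nP] := dD (h t) (ratr q) q0.
  have q0' : 0 < q by rewrite -(@ltr0q R).
  exists (n, q) => //=; rewrite q0'/=; case: asboolP => // BU; exfalso;
    apply: BU.
  move=> y; rewrite /B/= => yq; apply: eU.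
  rewrite (le_lt_trans (ler_rnormB _ (D n) _))// (rnormB (D n)).
  by rewrite (splitr e) ltrD// (lt_trans _ qe).
rewrite bigcup_mkcond; apply: countable_bigcupT_measurable => [|p];
  first exact: countableP.
rewrite in_setT; case: ifP => // /andP[p0 _]; rewrite /preimage/B/=.
by apply: mh; rewrite ltr0q.
Qed.

End ComplexNormedModule.

(** * The space l2 *)

Section L2Sequence.
Context {R : realType} {I : choiceType} (e : nat -> I) (e_bij : bijective e).
Local Notation C := R[i].
Local Notation l2 := (l2 R I).

Lemma esum_nat (f : I -> \bar R) : (forall i, (0 <= f i)%E) ->
  (\esum_(i in [set: I]) f i = \sum_(n <oo) f (e n))%E.
Proof.
move=> f0; rewrite nneseries_esumT//; apply: reindex_esum.
by rewrite setTT_bijective.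
Qed.

Lemma rnorm_l2 (a : l2) : rnorm a = l2_norm a.
Proof. by []. Qed.

Lemma sumsq_nat (a : I -> C^o) :
  sumsq a = (\sum_(n <oo) (normc (a (e n)) ^+ 2)%:E)%E.
Proof. by apply: esum_nat => i; rewrite lee_fin sqr_ge0. Qed.

Lemma sumsq_le (a : I -> C^o) (M : R) :
  (forall n, \sum_(k < n) normc (a (e k)) ^+ 2 <= M) -> (sumsq a <= M%:E)%E.
Proof.
move=> aM; rewrite sumsq_nat; apply: lime_le.
  by apply: is_cvg_nneseries => n _ _; rewrite lee_fin sqr_ge0.
by apply: nearW => n; rewrite big_mkord sumEFin lee_fin.
Qed.

Lemma sum_le_rnorm (a : l2) n :
  \sum_(k < n) normc (a (e k)) ^+ 2 <= rnorm a ^+ 2.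
Proof.
rewrite -lee_fin rnorm_l2 -sumsqE sumsq_nat -sumEFin
  -(big_mkord xpredT (fun k => (normc (a (e k)) ^+ 2)%:E)).
by apply: nneseries_lim_ge => k _; rewrite lee_fin sqr_ge0.
Qed.

Lemma rnorm_l2_le (a : l2) (M : R) : 0 <= M ->
  (forall n, \sum_(k < n) normc (a (e k)) ^+ 2 <= M ^+ 2) -> rnorm a <= M.
Proof.
move=> M0 aM; rewrite -(@ler_pXn2r _ 2)// ?nnegrE ?rnorm_ge0//.
by rewrite -lee_fin rnorm_l2 -sumsqE sumsq_le.
Qed.

Lemma normc_le_rnorm (a : l2) i : normc (a i) <= rnorm a.
Proof.
have [g eg ge] := e_bij; rewrite -(@ler_pXn2r _ 2)// ?nnegrE ?rnorm_ge0
  ?normc_ge0//.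
rewrite (le_trans _ (sum_le_rnorm a (g i).+1))// big_ord_recr/= ge.
by rewrite lerDr sumr_ge0// => k _; rewrite sqr_ge0.
Qed.

Lemma ge0_sum_cvg (h : I -> R) : (forall i, 0 <= h i) ->
  (\esum_(i in [set: I]) (h i)%:E < +oo)%E ->
  \sum_(k < n) h (e k) @[n --> \oo] --> fine (\esum_(i in [set: I]) (h i)%:E).
Proof.
move=> h0 hoo; set s := (\esum_(_ in _) _)%E in hoo *.
have s_fin : s \is a fin_num.
  by rewrite ge0_fin_numE//; apply: esum_ge0 => i _; rewrite lee_fin.
have cs : (\sum_(0 <= k < n) (h (e k))%:E)%E @[n --> \oo] --> (fine s)%:E.
  rewrite fineK// /s esum_nat; last by move=> i; rewrite lee_fin.
  by apply: is_cvg_nneseries => n _ _; rewrite lee_fin.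
apply: (cvg_trans _ (fine_cvg cs)); apply: near_eq_cvg; apply: nearW => n /=.
by rewrite big_mkord sumEFin.
Qed.

Lemma rnorm_l2_cvg (a : l2) :
  \sum_(k < n) normc (a (e k)) ^+ 2 @[n --> \oo] --> rnorm a ^+ 2.
Proof.
rewrite (_ : rnorm a ^+ 2 = fine (sumsq a)); last first.
  by rewrite sumsqE.
apply: ge0_sum_cvg => [i|]; first exact: sqr_ge0.
by rewrite -/(sumsq a) sumsqE ltry.
Qed.

Lemma l2_sumE (J : Type) (r : seq J) (P : pred J) (F : J -> l2) i :
  (\sum_(j <- r | P j) F j) i = \sum_(j <- r | P j) (F j i).
Proof. by elim/big_rec2: _ => // j _ x _ <-. Qed.

Lemma l2_scaleE (c : C) (a : l2) i : (c *: a) i = c * a i. Proof. by []. Qed.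

Lemma l2_addE (a b : l2) i : (a + b) i = a i + b i. Proof. by []. Qed.

Lemma l2_subE (a b : l2) i : (a - b) i = a i - b i. Proof. by []. Qed.

Definition delta_fun (i : I) : I -> C^o := fun j => if j == i then 1 else 0.

Lemma sumsq_delta_fun i : sumsq (delta_fun i) = 1%E.
Proof.
rewrite -[RHS](@esum_set1 R _ i (fun=> 1%E))// [RHS]esum_mkcond.
apply: eq_esum => j _; rewrite in_set1 /delta_fun.
by case: ifPn => _; rewrite ?normc1 ?normc0 ?expr1n ?expr0n.
Qed.

Fact delta_fun_l2 i : delta_fun i \in @l2_pred R I.
Proof. by rewrite inE sumsq_delta_fun ltry. Qed.

Definition delta i : l2 := L2 (delta_fun_l2 i).

Lemma deltaE i j : delta i j = if j == i then 1 else 0. Proof. by []. Qed.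

Lemma rnorm_delta i : rnorm (delta i) = 1.
Proof. by rewrite rnorm_l2 /l2_norm sumsq_delta_fun sqrtr1. Qed.

Lemma l2_truncE (a : l2) n m :
  (\sum_(k < n) (a (e k) : C) *: delta (e k)) (e m) =
  if (m < n)%N then a (e m) else 0.
Proof.
rewrite l2_sumE; case: ifPn => mn; last first.
  rewrite big1// => k _; rewrite l2_scaleE deltaE (inj_eq (bij_inj e_bij)).
  by rewrite gtn_eqF ?mulr0// (leq_trans (ltn_ord k))// leqNgt.
rewrite (bigD1 (Ordinal mn))// big1.
  by rewrite [LHS]addr0 l2_scaleE deltaE eqxx mulr1.
move=> k /andP[_ km]; rewrite l2_scaleE deltaE (inj_eq (bij_inj e_bij)).
by rewrite -[m]/(val (Ordinal mn)) val_eqE eq_sym (negbTE km) mulr0.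
Qed.

(** The remainder lives on the indices from [n] on, so the head of the series can be subtracted from
    the squared norm of [a]. *)
Lemma trunc_rnorm_le (a : l2) n :
  rnorm (a - \sum_(k < n) (a (e k) : C) *: delta (e k)) ^+ 2 <=
  rnorm a ^+ 2 - \sum_(k < n) normc (a (e k)) ^+ 2.
Proof.
set M := rnorm a ^+ 2 - _.
have M0 : 0 <= M by rewrite subr_ge0 sum_le_rnorm.
rewrite -[leRHS]sqr_sqrtr// ler_pXn2r ?nnegrE ?rnorm_ge0 ?sqrtr_ge0//.
apply: rnorm_l2_le; first exact: sqrtr_ge0.
(* Comparison with the partial sum of [a] of length [n + m] leaves room for the head and for [m]
   terms of the remainder, whichever of [m] and [n] is larger. *)
move=> m; rewrite sqr_sqrtr// lerBrDr (le_trans _ (sum_le_rnorm a (n + m)))//.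
rewrite big_split_ord [leLHS]addrC lerD2l.
have -> : \sum_(i < m) normc (a (e (n + i)%N)) ^+ 2 =
    \sum_(n <= i < n + m) normc (a (e i)) ^+ 2.
  rewrite -[X in _ = \sum_(X <= _ < _) _]add0n big_addn addKn big_mkord.
  by apply: eq_bigr => i _; rewrite addnC.
rewrite -(big_mkord xpredT (fun k =>
  normc ((a - \sum_(k < n) (a (e k) : C) *: delta (e k)) (e k)) ^+ 2)).
have E k : normc ((a - \sum_(k < n) (a (e k) : C) *: delta (e k)) (e k)) ^+ 2 =
    if (k < n)%N then 0 else normc (a (e k)) ^+ 2.
  by rewrite l2_subE l2_truncE; case: ifPn => _;
    rewrite ?subrr ?subr0// normc0 expr0n.
rewrite (eq_bigr _ (fun k _ => E k)).
have [mn|nm] := leqP m n.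
  rewrite big_nat big1 ?sumr_ge0//; first by move=> i _; exact: sqr_ge0.
  by move=> k /andP[_ km]; rewrite (leq_trans km).
rewrite (big_cat_nat (n := n))//=; last exact: ltnW.
rewrite big_nat big1 ?add0r; last by move=> k /andP[_ ->].
rewrite [leRHS](big_cat_nat (n := m))//=; last first.
- exact: leq_addl.
- exact: ltnW.
rewrite -[leLHS]addr0 lerD ?sumr_ge0//; last by move=> i _; exact: sqr_ge0.
by apply: ler_sum => i _; case: ifP => // _; exact: sqr_ge0.
Qed.

Lemma delta_dense (a : l2) : closed_span (range (delta \o e)) a.
Proof.
have sM := closed_span_subspace (range (delta \o e)).
refine (closed_subspace_approx sM _) => eps eps0.
have e2 : 0 < eps ^+ 2 by rewrite exprn_gt0.
have /cvgrPdist_lt/(_ _ e2)[N _ /(_ N (leqnn N))] := @rnorm_l2_cvg a.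
move=> /= aN; exists (\sum_(k < N) (a (e k) : C) *: delta (e k)).
  apply: (closed_subspace_sum _ _ sM) => k; apply: (closed_subspaceZ _ sM).
  by apply: sub_closed_span; exists (nat_of_ord k).
rewrite -(@ltr_pXn2r _ 2)// ?nnegrE ?rnorm_ge0 ?(ltW eps0)//.
by rewrite (le_lt_trans (trunc_rnorm_le _ _))// (le_lt_trans _ aN)// ler_norm.
Qed.

Lemma real_cauchy (x : nat -> R) :
  (forall eps, 0 < eps ->
    exists N, forall n, (N <= n)%N -> `|x N - x n| < eps) -> cvgn x.
Proof.
move=> cx; apply/cauchy_cvgP/cauchy_exP => eps eps0.
by have [N NP] := cx _ eps0; exists (x N); exists N => // n /= /NP.
Qed.

(** The candidate is the coordinatewise limit. The Cauchy bound passes to the limit in each finite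
    sum of coordinates, uniformly in its length, and hence to the norm. *)
Lemma l2_complete (u : nat -> l2) :
  (forall eps, 0 < eps -> exists N, forall n m, (N <= n)%N -> (N <= m)%N ->
    rnorm (u n - u m) < eps) ->
  exists a, forall eps, 0 < eps -> exists N, forall n, (N <= n)%N ->
    rnorm (u n - a) <= eps.
Proof.
move=> cu.
have cvRe i : cvgn (fun n => complex.Re (u n i)).
  apply: real_cauchy => eps /cu[N NP]; exists N => n Nn.
  rewrite -raddfB (le_lt_trans (ler_Re_normc _))//.
  exact: le_lt_trans (normc_le_rnorm (u N - u n) i) (NP _ _ (leqnn _) Nn).
have cvIm i : cvgn (fun n => complex.Im (u n i)).
  apply: real_cauchy => eps /cu[N NP]; exists N => n Nn.
  rewrite -raddfB (le_lt_trans (ler_Im_normc _))//.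
  exact: le_lt_trans (normc_le_rnorm (u N - u n) i) (NP _ _ (leqnn _) Nn).
pose a : I -> C^o := fun i => limn (fun n => complex.Re (u n i)) +i* limn
  (fun n => complex.Im (u n i)).
have le_a eps N : 0 < eps -> (forall n m, (N <= n)%N -> (N <= m)%N ->
  rnorm (u n - u m) < eps) ->
    forall n K, (N <= n)%N -> \sum_(k < K) normc (u n (e k) - a (e k)) ^+ 2 <=
      eps ^+ 2.
  move=> eps0 NP n K Nn.
  have cn : \sum_(k < K) normc (u n (e k) - u m (e k)) ^+ 2 @[m --> \oo] -->
      \sum_(k < K) normc (u n (e k) - a (e k)) ^+ 2.
    have E (x y : C) : normc (x - y) ^+ 2 =
        (complex.Re x - complex.Re y) * (complex.Re x - complex.Re y) +
        (complex.Im x - complex.Im y) * (complex.Im x - complex.Im y).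
      by rewrite normc_sqr !raddfB.
    rewrite (eq_bigr _ (fun k _ => E _ _)).
    under eq_cvg do rewrite (eq_bigr _ (fun k _ => E _ _)).
    apply: cvg_big => [|k _]; first exact: add_continuous.
    apply: cvgD.
      by apply: cvgM; apply: cvgB;
        [exact: cvg_cst|exact: cvRe|exact: cvg_cst|exact: cvRe].
    by apply: cvgM; apply: cvgB;
      [exact: cvg_cst|exact: cvIm|exact: cvg_cst|exact: cvIm].
  apply: (cvgr_to_le cn); exists N => // m /= Nm.
  rewrite (le_trans (sum_le_rnorm (u n - u m) K))// ler_pXn2r ?nnegrE
    ?rnorm_ge0 ?(ltW eps0)//.
  exact: ltW (NP _ _ Nn Nm).
have [N0 N0P] := cu 1 ltr01.
have ba : (fun i => u N0 i - a i : C^o) \in @l2_pred R I.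
  rewrite inE; apply: le_lt_trans (sumsq_le (M := 1) _) (ltry _) => n.
  by have := le_a _ _ ltr01 N0P N0 n (leqnn _); rewrite expr1n.
(* Square summability is known for [u N0 - a] rather than for [a], so the limit is written as a
   difference of two elements of [l2]. *)
exists (u N0 - L2 ba) => eps eps0; have [N NP] := cu _ eps0; exists N => n Nn.
apply: rnorm_l2_le; first exact: ltW.
move=> K; have := le_a _ _ eps0 NP n K Nn; congr (_ <= _).
apply: eq_bigr => k _; congr (normc _ ^+ 2).
rewrite -[(u n - _) (e k)]/(u n (e k) - (u N0 (e k) - (u N0 (e k) - a (e k)))).
by rewrite subKr.
Qed.

End L2Sequence.

(** * The inner product of [l2] *)

Section L2Dot.
Context {R : realType} {I : choiceType} (e : nat -> I) (e_bij : bijective e).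
Local Notation C := R[i].
Local Notation l2 := (l2 R I).
Local Notation dot := (@l2_dot R I).

(** Positive and negative parts are both dominated by the absolute value. As a limit of finite sums,
    [real_sum] is visibly linear, which its definition by parts hides. *)
Lemma real_sum_cvg (f : I -> R) :
  (\esum_(i in [set: I]) (`|f i|)%:E < +oo)%E ->
  \sum_(k < n) f (e k) @[n --> \oo] --> real_sum f.
Proof.
move=> foo.
have cvgp (g : I -> R) : (forall i, 0 <= g i) -> (forall i, g i <= `|f i|) ->
    \sum_(k < n) g (e k) @[n --> \oo] --> fine (\esum_(i in [set: I]) (g i)%:E).
  move=> g0 gf; apply: ge0_sum_cvg => //; apply: le_lt_trans foo.
  by apply: le_esum => i _; rewrite lee_fin.
rewrite (_ : (fun n => _) = (fun n => \sum_(k < n) Num.max (f (e k)) 0 -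
    \sum_(k < n) Num.max (- f (e k)) 0)).
  apply: cvgB.
    apply: (cvgp (fun i => Num.max (f i) 0)) => i;
      first by rewrite le_max lexx orbT.
    by rewrite ge_max normr_ge0 ler_norm.
  apply: (cvgp (fun i => Num.max (- f i) 0)) => i;
    first by rewrite le_max lexx orbT.
  by rewrite ge_max normr_ge0 -normrN ler_norm.
apply/funext => n; rewrite -sumrB; apply: eq_bigr => k _.
set x := f _; rewrite !maxEle; case: ifPn => x0; case: ifPn => y0; lra.
Qed.

(** Convergence is kept on real and imaginary parts, so that limit theorems for real sequences
    apply. *)
Definition ccvg (u : nat -> C) (l : C) :=
  complex.Re (u n) @[n --> \oo] --> complex.Re l /\
  complex.Im (u n) @[n --> \oo] --> complex.Im l.

Lemma ccvg_unique u l l' : ccvg u l -> ccvg u l' -> l = l'.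
Proof.
move=> [ul1 ul2] [ul1' ul2'].
apply/eqP; rewrite eq_complex; apply/andP; split; apply/eqP.
  exact: (cvg_unique _ ul1 ul1').
exact: (cvg_unique _ ul2 ul2').
Qed.

Lemma ccvgD u v l m : ccvg u l -> ccvg v m -> ccvg (fun n => u n + v n) (l + m).
Proof.
move=> [u1 u2] [v1 v2]; split; rewrite raddfD.
  by under eq_cvg do rewrite raddfD; exact: cvgD.
by under eq_cvg do rewrite raddfD; exact: cvgD.
Qed.

Lemma cReM (x y : C) : complex.Re (x * y) =
  complex.Re x * complex.Re y - complex.Im x * complex.Im y.
Proof. by case: x y => ? ? []. Qed.

Lemma cImM (x y : C) : complex.Im (x * y) =
  complex.Re x * complex.Im y + complex.Im x * complex.Re y.
Proof. by case: x y => ? ? []. Qed.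

Lemma cReD (x y : C) : complex.Re (x + y) = complex.Re x + complex.Re y.
Proof. by case: x y => ? ? []. Qed.

Lemma cReN (x : C) : complex.Re (- x) = - complex.Re x.
Proof. by case: x. Qed.

Lemma conjcN1 : conjc (-1 : C) = -1.
Proof. exact: rmorphN1. Qed.

Lemma cReJ (x : C) : complex.Re (conjc x) = complex.Re x.
Proof. by case: x. Qed.

Lemma cImJ (x : C) : complex.Im (conjc x) = - complex.Im x.
Proof. by case: x. Qed.

Lemma conjcM (x y : C) : conjc (x * y) = conjc x * conjc y.
Proof. exact: rmorphM. Qed.

Lemma conjcD (x y : C) : conjc (x + y) = conjc x + conjc y.
Proof. exact: rmorphD. Qed.

Lemma ccvgMl c u l : ccvg u l -> ccvg (fun n => c * u n) (c * l).
Proof.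
move=> [u1 u2]; split; rewrite ?cReM ?cImM.
  under eq_cvg do rewrite cReM.
  by apply: cvgB; apply: cvgM => //; exact: cvg_cst.
under eq_cvg do rewrite cImM.
by apply: cvgD; apply: cvgM => //; exact: cvg_cst.
Qed.

Lemma ccvg_conj u l : ccvg u l -> ccvg (fun n => conjc (u n)) (conjc l).
Proof.
move=> [u1 u2]; split; rewrite ?cReJ ?cImJ.
  by under eq_cvg do rewrite cReJ.
by under eq_cvg do rewrite cImJ; exact: cvgN.
Qed.

Definition dotn n (a b : l2) : C :=
  \sum_(k < n) (a (e k) : C) * conjc (b (e k) : C).

(** The sum of the squares dominates the product of two moduli, whence absolute summability.
    Sesquilinearity of [l2_dot] then follows from that of the finite sums [dotn] by uniqueness of
    limits. *)
Lemma dot_cvg (a b : l2) : ccvg (fun n => dotn n a b) (dot a b).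
Proof.
have ab_oo : (\esum_(i in [set: I]) (normc ((a i : C) * conjc (b i : C)))%:E <
  +oo)%E.
  have h : (\esum_(i in [set: I]) ((normc (a i) ^+ 2)%:E +
    (normc (b i) ^+ 2)%:E) < +oo)%E.
    rewrite esumD; try by move=> i _; rewrite lee_fin sqr_ge0.
    by rewrite -/(sumsq a) -/(sumsq b) !sumsqE ltry.
  apply: le_lt_trans h; apply: le_esum => i _; rewrite -EFinD lee_fin normcM.
  have -> : normc (conjc (b i : C)) = normc (b i) by case: (b i) => x y /=;
    rewrite sqrrN.
  set x := normc (a i); set y := normc (b i).
  have := sqr_ge0 (x - y); have := sqr_ge0 (x + y); rewrite !expr2; lra.
split.
  under eq_cvg do rewrite raddf_sum.
  apply: real_sum_cvg; apply: le_lt_trans ab_oo.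
  by apply: le_esum => i _; rewrite lee_fin ler_Re_normc.
under eq_cvg do rewrite raddf_sum.
apply: real_sum_cvg; apply: le_lt_trans ab_oo.
by apply: le_esum => i _; rewrite lee_fin ler_Im_normc.
Qed.

Lemma l2_dotPl c (a a' b : l2) : dot (c *: a + a') b = c * dot a b + dot a' b.
Proof.
apply: (ccvg_unique (dot_cvg _ _)).
rewrite (_ : (fun n => _) = (fun n => c * dotn n a b + dotn n a' b)).
  by apply: ccvgD; [apply: ccvgMl|]; exact: dot_cvg.
apply/funext => n; rewrite /dotn mulr_sumr -big_split; apply: eq_bigr => k _.
by rewrite l2_addE l2_scaleE mulrDl mulrA.
Qed.

Lemma l2_dotC (a b : l2) : dot b a = conjc (dot a b).
Proof.
apply: (ccvg_unique (dot_cvg _ _)).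
rewrite (_ : (fun n => _) = (fun n => conjc (dotn n a b))).
  by apply: ccvg_conj; exact: dot_cvg.
apply/funext => n; rewrite /dotn rmorph_sum; apply: eq_bigr => k _.
by rewrite [RHS]conjcM conjcK mulrC.
Qed.

Lemma l2_dotxx (a : l2) : dot a a = (rnorm a ^+ 2)%:C.
Proof.
apply: (ccvg_unique (dot_cvg _ _)).
rewrite (_ : (fun n => _) = (fun n => (\sum_(k < n) normc (a (e k)) ^+ 2)%:C)).
  by split => /=; [exact: rnorm_l2_cvg|exact: cvg_cst].
apply/funext => n; rewrite /dotn rmorph_sum; apply: eq_bigr => k _.
by rewrite -sqr_normc normr_normc rmorphXn.
Qed.

Lemma l2_dot0l (b : l2) : dot 0 b = 0.
Proof.
by have := l2_dotPl (-1) 0 0 b; rewrite scaler0 addr0 mulN1r addNr.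
Qed.

Lemma l2_dotZl c (a b : l2) : dot (c *: a) b = c * dot a b.
Proof. by rewrite -[c *: a]addr0 l2_dotPl l2_dot0l addr0. Qed.

Lemma l2_dotDl (a a' b : l2) : dot (a + a') b = dot a b + dot a' b.
Proof. by rewrite -[a in LHS]scale1r l2_dotPl mul1r. Qed.

Lemma l2_dotBl (a a' b : l2) : dot (a - a') b = dot a b - dot a' b.
Proof. by rewrite l2_dotDl -scaleN1r l2_dotZl mulN1r. Qed.

Lemma l2_dotDr (a b b' : l2) : dot a (b + b') = dot a b + dot a b'.
Proof. by rewrite l2_dotC l2_dotDl conjcD -!l2_dotC. Qed.

Lemma l2_dotZr c (a b : l2) : dot a (c *: b) = conjc c * dot a b.
Proof. by rewrite l2_dotC l2_dotZl conjcM -!l2_dotC. Qed.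

Lemma rnorm_sqrE (a : l2) : rnorm a ^+ 2 = complex.Re (dot a a).
Proof. by rewrite l2_dotxx. Qed.

Lemma rnorm_sqrD (a b : l2) :
  rnorm (a + b) ^+ 2 = rnorm a ^+ 2 + 2 * complex.Re (dot a b) + rnorm b ^+ 2.
Proof.
rewrite !rnorm_sqrE l2_dotDl !l2_dotDr !cReD (l2_dotC a b) cReJ.
by rewrite mulr2n mulrDl mul1r !addrA.
Qed.

Lemma parallelogram (a b : l2) :
  rnorm (a + b) ^+ 2 + rnorm (a - b) ^+ 2 = 2 * rnorm a ^+ 2 + 2 * rnorm b ^+ 2.
Proof.
rewrite (rnorm_sqrD a b) (rnorm_sqrD a (- b)) rnormN.
rewrite -[- b]scaleN1r (l2_dotZr (-1) a b).
have -> : complex.Re (conjc (-1) * dot a b) = - complex.Re (dot a b).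
  by rewrite conjcN1 mulN1r cReN.
set x := complex.Re _; set y := rnorm _; set z := rnorm _; ring.
Qed.

End L2Dot.

(** * Orthogonal projections in [l2] *)

Section L2Projection.
Context {R : realType} {I : choiceType} (e : nat -> I) (e_bij : bijective e).
Local Notation C := R[i].
Local Notation l2 := (l2 R I).
Local Notation dot := (@l2_dot R I).
Implicit Types (M : set l2) (x y z : l2).

(** A minimizing sequence for the squared distance is Cauchy by the parallelogram identity, and its
    limit stays in the closed set [M]. *)
Lemma l2_min_dist M x : closed_subspace M ->
  exists2 y, M y & forall z, M z -> rnorm (x - y) <= rnorm (x - z).
Proof.
move=> sM; have [M0 MD _] := sM.
pose D := [set rnorm (x - z) ^+ 2 | z in M]; pose d := inf D.
have D0 : D !=set0 by exists (rnorm (x - 0) ^+ 2), 0.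
have lbD : lbound D 0 by move=> _ [z _ <-]; exact: sqr_ge0.
have infD : has_inf D by split=> //; exists 0.
have dD z : M z -> d <= rnorm (x - z) ^+ 2.
  by move=> Mz; apply: ge_inf; [exists 0|exists z].
have d0 : 0 <= d by apply: lb_le_inf.
have /choice[u uP] : forall n : nat, exists y, M y /\ rnorm (x - y) ^+ 2 < d +
  n.+1%:R^-1.
  move=> n; have n0 : 0 < n.+1%:R^-1 :> R by rewrite invr_gt0.
  by have [_ [y My <-] yd] := inf_adherent n0 infD; exists y.
(* The midpoint of [y] and [z] lies in [M], so its squared distance to [x] is at least [d]; this
   bounds one term of the parallelogram from below. *)
have mid y z : M y -> M z ->
    rnorm (y - z) ^+ 2 <= 2 * (rnorm (x - y) ^+ 2 - d) +
      2 * (rnorm (x - z) ^+ 2 - d).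
  move=> My Mz; have := parallelogram e_bij (x - z) (x - y).
  have -> : x - z - (x - y) = y - z by rewrite opprB addrC addrA subrK.
  have -> : x - z + (x - y) = (2 : C) *: (x - (2^-1 : C) *: (y + z)).
    rewrite scalerBr scalerA divff ?pnatr_eq0// scale1r scaler_nat mulr2n.
    by rewrite opprD addrACA [- y + _]addrC.
  rewrite rnormZ.
  have -> : normc (2 : C) = 2.
    by have := normc_real (2 : R); rewrite rmorph_nat ger0_norm.
  rewrite exprMn => H.
  have Mm : M ((2^-1 : C) *: (y + z)).
    by apply: (closed_subspaceZ _ sM); rewrite -[y]scale1r; exact: MD.
  have := dD _ Mm.
  set p := rnorm (x - _ *: _) in H *; move: H.
  set q := rnorm (y - z); set r := rnorm (x - z); set s := rnorm (x - y).
  by clearbody d p q r s; move: (p ^+ 2) (q ^+ 2) (r ^+ 2) (s ^+ 2) => *; lra.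
(* To be used with [E = eps ^+ 2]: both excesses over the infimum are below [E / 4], and twice each
   of them adds up to less than [E]. *)
have arith (a b c i j E D' : R) : a < D' + i -> b < D' + j -> i < E / 4 ->
  j < E / 4 ->
    c <= 2 * (a - D') + 2 * (b - D') -> c < E by lra.
have smallinv eps : 0 < eps -> exists N : nat, forall n, (N <= n)%N ->
  n.+1%:R^-1 < eps :> R.
  move=> eps0; have [N _ NP] := near_infty_natSinv_lt (PosNum eps0).
  by exists N => n Nn; exact: NP.
have [|y yP] := l2_complete e_bij (u := u).
  move=> eps eps0; have [|N NP] := smallinv (eps ^+ 2 / 4).
    by rewrite divr_gt0// exprn_gt0.
  exists N => n m /NP Nn /NP Nm.
  rewrite -(@ltr_pXn2r _ 2)// ?nnegrE ?rnorm_ge0 ?(ltW eps0)//.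
  have [Mn n_d] := uP n; have [Mm m_d] := uP m.
  exact: arith n_d m_d Nn Nm (mid _ _ Mn Mm).
have My : M y.
  apply: (closed_subspace_approx sM) => eps eps0.
  have [|N NP] := yP (eps / 2); first by rewrite divr_gt0.
  exists (u N); first by have [] := uP N.
  by rewrite rnormB (le_lt_trans (NP _ (leqnn _)))// ltr_pdivrMr// ltr_pMr//
    ltr1n.
exists y => // z Mz.
rewrite -(@ler_pXn2r _ 2)// ?nnegrE ?rnorm_ge0//.
apply: le_trans (dD z Mz).
rewrite -[d]sqr_sqrtr// ler_pXn2r ?nnegrE ?rnorm_ge0 ?sqrtr_ge0//.
apply/ler_addgt0Pr => eps eps0.
have e2 : 0 < eps / 2 by rewrite divr_gt0.
have [N1 N1P] := yP _ e2.
(* This tolerance suits squares: [d + (eps / 2) ^+ 2] is at most the square of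
   [Num.sqrt d + eps / 2]. *)
have [|N2 N2P] := smallinv ((eps / 2) ^+ 2); first by rewrite exprn_gt0.
pose n := maxn N1 N2; rewrite (le_trans (ler_rnormB _ (u n) _))//.
rewrite (splitr eps) addrA lerD//; last by apply: N1P; rewrite leq_maxl.
rewrite -(@ler_pXn2r _ 2)// ?nnegrE ?rnorm_ge0 ?addr_ge0 ?sqrtr_ge0 ?(ltW e2)//.
have [_ /ltW/le_trans] := uP n; apply.
rewrite sqrrD sqr_sqrtr// -addrA lerD2l.
have := N2P n (leq_maxr _ _) => /ltW/le_trans; apply.
by rewrite lerDr mulrn_wge0// mulr_ge0 ?sqrtr_ge0 ?ltW.
Qed.

(** The nearest point works: if [x - y] had a component along some [z] in [M], moving [y] along [z]
    would shorten the distance. *)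
Lemma orth_proj_exists M x : closed_subspace M ->
  exists y, M y /\ forall z, M z -> dot (x - y) z = 0.
Proof.
move=> sM; have [M0 MD _] := sM; have [y My yP] := l2_min_dist x sM.
exists y; split=> // z Mz.
have {}yP (c : C) : rnorm (x - y) <= rnorm (x - y + (- c) *: z).
  have -> : x - y + (- c) *: z = x - (c *: z + y).
    by rewrite opprD addrCA scaleNr addrC.
  by apply: yP; exact: MD.
move: (x - y) yP => {My y x} w yP.
have key (c : C) : 0 <= - 2 * complex.Re (conjc c * dot w z) +
  normc c ^+ 2 * rnorm z ^+ 2.
  have := yP c; rewrite -(@ler_pXn2r _ 2)// ?nnegrE ?rnorm_ge0//.
  rewrite (rnorm_sqrD e_bij w ((- c) *: z)).
  rewrite (l2_dotZr e_bij (- c) w z).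
  rewrite (rnormZ (- c) z).
  rewrite normcN.
  rewrite (exprMn 2 (normc c) (rnorm z)).
  have -> : complex.Re (conjc (- c) * dot w z) =
    - complex.Re (conjc c * dot w z).
    by rewrite -cReN -mulNr; congr (complex.Re (_ * _)); case: (c) => ? ?.
  move: (complex.Re _) (rnorm w ^+ 2) (normc c ^+ 2 * _) => *; lra.
have z2 : 0 <= rnorm z ^+ 2 by exact: sqr_ge0.
set t : R := (rnorm z ^+ 2 + 1)^-1.
have t0 : 0 < t by rewrite invr_gt0; lra.
(* With c = t <w, z> and t |z|^2 < 1, minimality forces <w, z> = 0. *)
have := key (t%:C * dot w z); move: (dot w z) => u {key yP}.
have -> : complex.Re (conjc (t%:C * u) * u) = t * normc u ^+ 2.
  rewrite conjcM conjc_real normc_sqr; case: u => a b /=; ring.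
rewrite normcM normc_real gtr0_norm// exprMn.
set A := normc _ ^+ 2; have A0 : 0 <= A by exact: sqr_ge0.
have tz : t * rnorm z ^+ 2 <= 1.
  by rewrite -ler_pdivlMl// invrK mulr1 lerDl.
move=> h; apply: eq0_normc; apply/eqP; rewrite -sqrf_eq0 -/A; apply/eqP.
have tA : 0 <= t * A by rewrite mulr_ge0// ltW.
have h2 : (t * A) * (t * rnorm z ^+ 2) <= t * A * 1 by rewrite ler_wpM2l.
have : t * A <= 0.
  have -> : t * A = 2 * (t * A) - t * A * 1 by ring.
  rewrite subr_le0; apply: le_trans h2; rewrite -subr_ge0.
  by apply: le_trans h _; rewrite le_eqVlt; apply/orP; left; apply/eqP; ring.
by rewrite pmulr_rle0// => A1; apply/eqP; rewrite eq_le A1 A0.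
Qed.

Lemma orth_projP M x : closed_subspace M ->
  M (orth_proj dot M x) /\ forall z, M z -> dot (x - orth_proj dot M x) z = 0.
Proof.
move=> sM; rewrite /orth_proj; exact: (getPex (orth_proj_exists x sM)).
Qed.

Lemma orth_proj_in M x : closed_subspace M -> M (orth_proj dot M x).
Proof. by move=> /(orth_projP x)[]. Qed.

Lemma orth_proj_uniq M x y : closed_subspace M -> M y ->
  (forall z, M z -> dot (x - y) z = 0) -> orth_proj dot M x = y.
Proof.
move=> sM My yP; have [MP PP] := orth_projP x sM.
move: (orth_proj dot M x) MP PP => p Mp pP.
have Mpy := closed_subspaceB sM Mp My.
apply/eqP; rewrite -subr_eq0; apply/eqP/rnorm0_eq0/eqP.
rewrite -sqrf_eq0; apply/eqP/complexI; rewrite -(l2_dotxx e_bij).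
have {1}-> : p - y = (x - y) - (x - p).
  by rewrite opprB [RHS]addrC addrA subrK.
by rewrite (l2_dotBl e_bij (x - y) (x - p)) yP// pP// subrr.
Qed.

Lemma orth_proj_id M x : closed_subspace M -> M x -> orth_proj dot M x = x.
Proof.
move=> sM Mx; apply: orth_proj_uniq => // z Mz.
by rewrite subrr (l2_dot0l e_bij).
Qed.

Lemma orth_proj_linear M c x y : closed_subspace M ->
  orth_proj dot M (c *: x + y) = c *: orth_proj dot M x + orth_proj dot M y.
Proof.
move=> sM; have [_ MD _] := sM.
have [Mp pP] := orth_projP x sM; have [Mq qP] := orth_projP y sM.
move: (orth_proj dot M x) (orth_proj dot M y) Mp pP Mq qP => p q Mp pP Mq qP.
apply: orth_proj_uniq => //; first exact: MD.
move=> z Mz; rewrite opprD addrACA -scalerBr.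
by rewrite (l2_dotPl e_bij c (x - p) (y - q) z) pP// qP// mulr0 addr0.
Qed.

Lemma orth_proj_pythagoras M x z : closed_subspace M -> M z ->
  rnorm (x - z) ^+ 2 =
  rnorm (x - orth_proj dot M x) ^+ 2 + rnorm (orth_proj dot M x - z) ^+ 2.
Proof.
move=> sM Mz; have [Mp pP] := orth_projP x sM.
move: (orth_proj dot M x) Mp pP => p Mp pP.
have -> : x - z = (x - p) + (p - z) by rewrite addrA subrK.
rewrite (rnorm_sqrD e_bij (x - p)) pP ?mulr0 ?addr0//.
exact: closed_subspaceB.
Qed.

Lemma rnorm_orth_proj M x : closed_subspace M ->
  rnorm (orth_proj dot M x) ^+ 2 =
  rnorm x ^+ 2 - rnorm (x - orth_proj dot M x) ^+ 2.
Proof.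
move=> sM; have [M0 _ _] := sM; have := orth_proj_pythagoras x sM M0.
by rewrite !subr0 => ->; rewrite addrC addKr.
Qed.

Lemma orth_proj_le M x : closed_subspace M ->
  rnorm (orth_proj dot M x) <= rnorm x.
Proof.
move=> sM; rewrite -(@ler_pXn2r _ 2)// ?nnegrE ?rnorm_ge0//.
by rewrite rnorm_orth_proj// lerBlDr lerDl sqr_ge0.
Qed.

Lemma orth_proj_dist_le M x z : closed_subspace M -> M z ->
  rnorm (x - orth_proj dot M x) <= rnorm (x - z).
Proof.
move=> sM Mz; rewrite -(@ler_pXn2r _ 2)// ?nnegrE ?rnorm_ge0//.
by rewrite (orth_proj_pythagoras x sM Mz) lerDl sqr_ge0.
Qed.

(** With both arguments projected, polarization recovers the product from norms of projections
    alone. *)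
Lemma dot_orth_proj M x y : closed_subspace M ->
  dot (orth_proj dot M x) y = dot (orth_proj dot M x) (orth_proj dot M y).
Proof.
move=> sM; have [Mp pP] := orth_projP x sM; have [Mq qP] := orth_projP y sM.
move: (orth_proj dot M x) (orth_proj dot M y) Mp pP Mq qP => p q Mp pP Mq qP.
rewrite -[y in LHS](subrK q) (l2_dotDr e_bij p).
by rewrite (l2_dotC e_bij (y - q) p) qP// conjc0 add0r.
Qed.

Lemma Re_dotE x y :
  complex.Re (dot x y) = (rnorm (x + y) ^+ 2 - rnorm x ^+ 2 - rnorm y ^+ 2) / 2.
Proof.
rewrite (rnorm_sqrD e_bij x y).
by move: (complex.Re _) (rnorm x ^+ 2) (rnorm y ^+ 2) => a b c; field.
Qed.

Lemma Im_dotE x y : complex.Im (dot x y) = complex.Re (dot x ('i%C *: y)).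
Proof.
by rewrite (l2_dotZr e_bij 'i%C x y) cReM/= mul0r sub0r mulN1r opprK.
Qed.

(** The projection is the nearest point of the span and is itself a limit of rational combinations.
    The infimum is over a countable set, so it remains measurable when [v] depends on a
    parameter. *)
Lemma orth_proj_dist_qcomb (v : nat -> l2) x :
  rnorm (x - orth_proj dot (closed_span (range v)) x) =
  inf (range (fun s => rnorm (x - qcomb v s))).
Proof.
set M := closed_span (range v).
have sM : closed_subspace M by exact: closed_span_subspace.
apply/eqP; rewrite eq_le; apply/andP; split.
  apply: lb_le_inf; first by exists (rnorm (x - qcomb v [::])), [::].
  move=> _ [s _ <-]; apply: orth_proj_dist_le => //.
  by rewrite /M closed_span_range; apply: subset_closure; exists s.
apply/ler_addgt0Pr => eps eps0.
have : closure (range (qcomb v)) (orth_proj dot M x).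
  by rewrite -closed_span_range; exact: orth_proj_in.
move=> /closure_rnormP/(_ _ eps0)[_ [s _ <-] sP].
apply: (le_trans (y := rnorm (x - qcomb v s))).
  apply: ge_inf; last by exists s.
  by exists 0 => _ [t _ <-]; exact: rnorm_ge0.
apply: (le_trans (ler_rnormB x (orth_proj dot M x) (qcomb v s))).
rewrite lerD2l.
exact: (ltW sP).
Qed.

End L2Projection.

(** * Measurable functions with values in [R[i]] and in [l2] *)

Section Measurability.
Context {R : realType} {d : measure_display} {X : measurableType d}.
Local Notation C := R[i].

(** Both parts are asked to be measurable as real functions; [measurable_complex_preimage] recovers
    the preimages of open sets. *)
Definition measurable_complex (f : X -> C) :=
  measurable_fun setT (fun t => complex.Re (f t)) /\
  measurable_fun setT (fun t => complex.Im (f t)).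

Lemma measurable_complexD f g : measurable_complex f -> measurable_complex g ->
  measurable_complex (fun t => f t + g t).
Proof.
move=> [f1 f2] [g1 g2]; split.
  by under eq_fun do rewrite raddfD; exact: measurable_funD.
by under eq_fun do rewrite raddfD; exact: measurable_funD.
Qed.

Lemma measurable_complexM f g : measurable_complex f -> measurable_complex g ->
  measurable_complex (fun t => f t * g t).
Proof.
move=> [f1 f2] [g1 g2]; split.
  by under eq_fun do rewrite cReM; apply: measurable_funB;
    exact: measurable_funM.
by under eq_fun do rewrite cImM; apply: measurable_funD; exact: measurable_funM.
Qed.

Lemma measurable_complex_cst c : measurable_complex (fun=> c).
Proof. by split; exact: measurable_cst. Qed.

Lemma measurable_complex_real (f : X -> R) : measurable_fun setT f ->
  measurable_complex (fun t => (f t)%:C).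
Proof. by move=> mf; split => //=; exact: measurable_cst. Qed.

Lemma measurable_normc_sqr f : measurable_complex f ->
  measurable_fun setT (fun t => normc (f t) ^+ 2).
Proof.
move=> [f1 f2]; under eq_fun do rewrite normc_sqr.
by apply: measurable_funD; exact: measurable_funX.
Qed.

Lemma measurable_fun_openP (f : X -> R) :
  (forall c, measurable [set t | c < f t]) -> measurable_fun setT f.
Proof.
move=> mf; apply: (measurability _ (RGenOInfty.measurableE R)) => //.
move=> _ [_ [c ->] <-]; rewrite setTI preimage_itvoy; exact: mf.
Qed.

Lemma measurable_complex_preimage f U : measurable_complex f -> @open C^o U ->
  measurable (f @^-1` U).
Proof.
move=> mf oU.
pose D n : C^o := cratr (odflt (0, 0) (unpickle n)).
apply: (measurable_preimage_open (E := C^o) (D := D)) => // [x eps eps0|n r r0].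
  have [q qP] := cratr_dense x eps0.
  by exists (pickle q); rewrite /D pickleK.
rewrite (_ : [set _ | _] = [set t | normc (f t - D n) ^+ 2 < r ^+ 2]).
  have mn : measurable_fun setT (fun t => normc (f t - D n) ^+ 2).
    by apply: measurable_normc_sqr; apply: measurable_complexD.
  rewrite -[X in measurable X]setTI -preimage_itvNyo.
  exact: (mn measurableT _ (measurable_itv _)).
by apply/seteqP; split => t /=;
  rewrite ltr_pXn2r// ?nnegrE ?normc_ge0 ?(ltW r0).
Qed.

Context {I : choiceType} (e : nat -> I) (e_bij : bijective e).
Local Notation l2 := (l2 R I).
Implicit Types F G : X -> l2.

Lemma measurable_l2_lipschitz (f : l2 -> R) F :
  (forall x y, `|f x - f y| <= rnorm (x - y)) -> measurable_fun setT F ->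
  measurable_fun setT (fun t => f (F t)).
Proof.
move=> lf mF; apply: measurable_fun_openP => c.
rewrite -[X in measurable X]setTI; apply: (mF measurableT [set x | c < f x]).
by apply: sub_sigma_algebra; exact: open_lipschitz_gt.
Qed.

Lemma measurable_l2_coord F i : measurable_fun setT F ->
  measurable_complex (fun t => F t i).
Proof.
move=> mF; split.
  apply: (@measurable_l2_lipschitz (fun x => complex.Re (x i))) => // x y.
  rewrite -raddfB (le_trans (ler_Re_normc _))//.
  exact: (normc_le_rnorm e_bij (x - y) i).
apply: (@measurable_l2_lipschitz (fun x => complex.Im (x i))) => // x y.
rewrite -raddfB (le_trans (ler_Im_normc _))//.
exact: (normc_le_rnorm e_bij (x - y) i).
Qed.

(** Separability turns coordinatewise measurability into Borel measurability: rational combinations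
    of the [delta] are dense, and the squared distance to a fixed vector is a series of measurable
    functions of the coordinates. *)
Lemma measurable_l2P F :
  (forall i, measurable_complex (fun t => F t i)) -> measurable_fun setT F.
Proof.
move=> mF; apply: (@measurability _ _ X l2 setT F (@open l2)) => // _ [U oU <-].
rewrite setTI.
pose D n : l2 := qcomb (delta \o e) (odflt [::] (unpickle n)).
apply: (measurable_preimage_open (D := D)) => // [x eps eps0|n r r0].
  have := @delta_dense _ _ _ e_bij x; rewrite closed_span_range.
  move=> /closure_rnormP/(_ _ eps0)[_ [s _ <-] sP].
  by exists (pickle s); rewrite /D pickleK.
rewrite (_ : [set _ | _] =
    [set t | (\sum_(k <oo) (normc (F t (e k) - D n (e k)) ^+ 2)%:E <
      (r ^+ 2)%:E)%E]).
  rewrite -[X in measurable X]setTI.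
  apply: emeasurable_fun_infty_o => //.
  apply: (eq_measurable_fun (fun t =>
    \sum_(k <oo | k \in xpredT) (normc (F t (e k) - D n (e k)) ^+ 2)%:E)%E) =>
      [//|].
  apply: ge0_emeasurable_sum => [k t _ _|k _]; first by rewrite lee_fin sqr_ge0.
  apply/measurable_EFinP; apply: measurable_normc_sqr.
  by apply: measurable_complexD => //; exact: measurable_complex_cst.
apply/funext => t /=; apply/propext.
rewrite -(@ltr_pXn2r _ 2)// ?nnegrE ?rnorm_ge0 ?(ltW r0)//.
by rewrite -lte_fin rnorm_l2 -sumsqE (sumsq_nat e_bij).
Qed.

Lemma measurable_l2D F G : measurable_fun setT F -> measurable_fun setT G ->
  measurable_fun setT (fun t => F t + G t).
Proof.
move=> mF mG; apply: measurable_l2P => i.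
by apply: measurable_complexD; exact: measurable_l2_coord.
Qed.

Lemma measurable_l2Z f F : measurable_complex f -> measurable_fun setT F ->
  measurable_fun setT (fun t => f t *: F t).
Proof.
move=> mf mF; apply: measurable_l2P => i.
by apply: measurable_complexM => //; exact: measurable_l2_coord.
Qed.

Lemma measurable_l2B F G : measurable_fun setT F -> measurable_fun setT G ->
  measurable_fun setT (fun t => F t - G t).
Proof.
move=> mF mG; under eq_fun do rewrite -scaleN1r.
apply: measurable_l2D => //; apply: measurable_l2Z => //.
Qed.

Lemma measurable_l2_qcomb (v : X -> nat -> l2) s :
  (forall n, measurable_fun setT (v ^~ n)) ->
  measurable_fun setT (fun t => qcomb (v t) s).
Proof.
move=> mv; rewrite /qcomb; elim: s => [|p s IH].
  by under eq_fun do rewrite big_nil; exact: measurable_cst.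
under eq_fun do rewrite big_cons; apply: measurable_l2D => //.
by apply: measurable_l2Z => //; exact: measurable_complex_cst.
Qed.

Lemma measurable_rnorm F : measurable_fun setT F ->
  measurable_fun setT (fun t => rnorm (F t)).
Proof.
apply: measurable_l2_lipschitz => x y; rewrite ler_norml; apply/andP; split.
  by rewrite lerNl opprB lerBlDr rnormB (le_trans _ (rnormD _ _))// subrK.
by rewrite lerBlDr (le_trans _ (rnormD _ _))// subrK.
Qed.

End Measurability.

(** * The Borel sigma-algebra of the dual group *)

Lemma cvg_initial (S : choiceType) (T : topologicalType) (f : S -> T)
  (u : nat -> S) (s : S) :
  (fun n => f (u n)) @ \oo --> f s ->
  (u : nat -> initial_topology f) @ \oo --> (s : initial_topology f).
Proof.
move=> fu A; rewrite nbhsE => -[B [[D oD <-] Ds] BA].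
have [|N _ NP] := fu D; first by apply: open_nbhs_nbhs; split.
by exists N => // n /NP; exact: BA.
Qed.

Section DualBorel.
Context {R : realType} {Gamma : zmodType} (e : nat -> Gamma).
Context (e_surj : forall g, exists n, e n = g).
Local Notation C := R[i].
Local Notation dual := (dual R Gamma).

Lemma dual_cvg (psi : nat -> dual) (chi : dual) :
  (forall g, (fun n => psi n g) @ \oo --> chi g) -> psi @ \oo --> chi.
Proof.
move=> pw; apply: (@cvg_initial dual {ptws Gamma -> C^o} (@char_val R Gamma)).
apply/cvg_sup => g.
exact: (@cvg_initial (forall _ : Gamma, C^o) C^o (fun f => f g)).
Qed.

(** Otherwise every [k] gives a character outside [O] that is within [1 / (k + 1)] of [chi] on the
    first [k] elements, and these characters converge pointwise to [chi]. One integer serves as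
    number of coordinates and as tolerance. *)
Lemma dual_open_nbhs (O : set dual) (chi : dual) : open O -> O chi ->
  exists k : nat, forall psi : dual,
    (forall i, (i < k)%N -> normc (psi (e i) - chi (e i)) < k.+1%:R^-1) ->
    O psi.
Proof.
move=> oO Ochi; apply: contrapT => /forallNP hO.
have /choice[psi psiP] : forall k : nat, exists psi : dual,
    (forall i, (i < k)%N -> normc (psi (e i) - chi (e i)) < k.+1%:R^-1) /\
      ~ O psi.
  by move=> k; have /existsNP[psi /not_implyP[]] := hO k; exists psi.
suff h : psi @ \oo --> chi.
  have [|N _ NP] := h O; first by apply: open_nbhs_nbhs; split.
  by have [_] := psiP N; apply; exact: (NP _ (leqnn _)).
apply: dual_cvg => g; have [m <-] := e_surj g => A /nbhs_rnormP[eps eps0 epsA].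
have [N _ NP] := near_infty_natSinv_lt (PosNum eps0).
exists (maxn m.+1 N) => // n /=; rewrite geq_max => /andP[mn Nn].
apply: epsA; rewrite rnormB; have [h _] := psiP n.
exact: lt_trans (h _ mn) (NP _ Nn).
Qed.

Definition dual_ball (i : nat) (q : rat * rat) (r : R) : set dual :=
  [set chi | normc (chi (e i) - cratr q) < r].

Definition dual_balls : set (set dual) :=
  [set E | exists i q r, 0 < r /\ E = dual_ball i q r].

(** An open set is a countable union of finite intersections of balls with rational centres.
    Countability of the union is what puts it in the generated sigma-algebra. *)
Lemma measurable_dual_balls :
  @measurable _ dual `<=` <<s dual_balls >>.
Proof.
apply: smallest_sub; first exact: smallest_sigma_algebra.
move=> O oO; pose T := g_sigma_algebraType dual_balls.
(* The radius is halved so that two characters in the same set differ by less than [1 / (k + 1)] on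
   the first [k] elements, where [k] is [p.1]. *)
pose B (p : nat * seq (rat * rat)) : set T :=
  \bigcap_(i in `I_p.1) dual_ball i (nth (0, 0) p.2 i) ((p.1.+1)%:R^-1 / 2).
have mB p : measurable (B p).
  apply: (@fin_bigcap_measurable _ T) => // i _; apply: sub_sigma_algebra.
  by exists i, (nth (0, 0) p.2 i), (p.1.+1%:R^-1 / 2); split; rewrite ?divr_gt0.
suff -> : O = \bigcup_p (if `[< B p `<=` O >] then B p else set0).
  apply: (@countable_bigcupT_measurable _ T) => [|p]; first exact: countableP.
  by case: asboolP => _; [exact: mB|exact: measurable0].
apply/seteqP; split=> [chi Ochi|chi [p _]]; last first.
  by case: asboolP => // BO /BO.
have [k kP] := dual_open_nbhs oO Ochi.
have k0 : 0 < k.+1%:R^-1 / 2 :> R by rewrite divr_gt0.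
have /choice[q qP] : forall i, exists q, normc (chi (e i) - cratr q) <
  k.+1%:R^-1 / 2.
  by move=> i; exact: cratr_dense.
exists (k, mkseq q k) => //; case: asboolP => [_ i /= ik|BO].
  by rewrite /dual_ball/= nth_mkseq.
exfalso; apply: BO => psi psiB; apply: kP => i ik.
have := psiB i ik; rewrite /dual_ball/= nth_mkseq// => psiq.
have -> : psi (e i) - chi (e i) = (psi (e i) - cratr (q i)) -
  (chi (e i) - cratr (q i)).
  by rewrite opprB addrA subrK.
rewrite (le_lt_trans (le_normcD _ _))// normcN [ltRHS]splitr ltrD//.
Qed.

Lemma measurable_eval (g : Gamma) :
  measurable_complex (fun chi : dual => chi g : C).
Proof.
have cg : continuous (fun chi : dual => chi g : C^o).
  apply/continuousP => A oA;
    exists ((fun f : {ptws Gamma -> C^o} => f g) @^-1` A) => //.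
  have cg := @proj_continuous Gamma (fun=> C^o) g.
  exact: ((@continuousP {ptws Gamma -> C^o} C^o (fun f => f g)).1 cg A oA).
have op (f : C^o -> R) : (forall x y : C^o, `|f x - f y| <= rnorm (x - y)) ->
    measurable_fun setT (fun chi : dual => f (chi g)).
  move=> lf; apply: measurable_fun_openP => c; apply: sub_sigma_algebra.
  rewrite -[X in open X]/((fun chi : dual => chi g : C^o) @^-1`
    [set z | c < f z]).
  by apply: ((continuousP _).1 cg); exact: open_lipschitz_gt.
split; apply: op => x y; rewrite -raddfB.
  exact: ler_Re_normc.
exact: ler_Im_normc.
Qed.

End DualBorel.

(** * Multipliers of an invariant subspace *)

Section SignPolynomials.
Context {R : realType}.

(* The iterates are odd polynomials that fix 0, so on [-1, 1] they converge to
   the sign at every point, 0 included. *)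
Definition sign_step (x : R) : R := x * (3 - x ^+ 2) / 2.

(** The cubic is the Newton-Schulz step for the sign: it fixes [1] and [-1] with zero derivative. So
    [1 - sign_step x] and [1 + sign_step x] have double roots there, and the remaining linear
    factors are positive on [-1, 1]. *)
Lemma sign_step_bound (x : R) : `|x| <= 1 -> `|sign_step x| <= 1.
Proof.
rewrite !ler_norml => /andP[x1 x2]; rewrite /sign_step; apply/andP; split.
  have h : 0 <= (x + 1) ^+ 2 * (2 - x) by rewrite mulr_ge0 ?sqr_ge0//; lra.
  have -> : x * (3 - x ^+ 2) / 2 = (x + 1) ^+ 2 * (2 - x) / 2 - 1 by field.
  lra.
have h : 0 <= (x - 1) ^+ 2 * (2 + x) by rewrite mulr_ge0 ?sqr_ge0//; lra.
have -> : x * (3 - x ^+ 2) / 2 = 1 - (x - 1) ^+ 2 * (2 + x) / 2 by field.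
lra.
Qed.

Lemma sign_iter_bound n (x : R) : `|x| <= 1 -> `|iter n sign_step x| <= 1.
Proof. by move=> x1; elim: n => //= n; exact: sign_step_bound. Qed.

Lemma sign_iterN n (x : R) : iter n sign_step (- x) = - iter n sign_step x.
Proof.
by elim: n => //= n ->; rewrite /sign_step sqrrN; field.
Qed.

(** The iterates never fall below [x]. Each step multiplies the gap [1 - y] by
    [(1 - y) * (2 + y) / 2], which is at most [1 - y / 2], hence at most [1 - x / 2]. The rate
    depends on [x], so the convergence is pointwise. *)
Lemma sign_iter_pos n (x : R) : 0 < x -> x <= 1 ->
  x <= iter n sign_step x /\ 1 - iter n sign_step x <= (1 - x / 2) ^+ n.
Proof.
move=> x0 x1; elim: n => [|n [IH1 IH2]] /=; first by rewrite expr0;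
  split => //; lra.
have : iter n sign_step x <= 1.
  by apply: le_trans (ler_norm _) _; apply: sign_iter_bound;
    rewrite ger0_norm// ltW.
move: (iter n sign_step x) IH1 IH2 => y xy IH y1; rewrite /sign_step; split.
  apply: (le_trans xy); have -> : y * (3 - y ^+ 2) / 2 = y +
    y * (1 - y) * (1 + y) / 2 by field.
  by rewrite lerDl !mulr_ge0//; lra.
rewrite [leRHS]exprS.
have -> : 1 - y * (3 - y ^+ 2) / 2 = (1 - y) * ((1 - y) * (2 + y) / 2) by field.
have h1 : (1 - y) * (2 + y) / 2 <= 1 - x / 2.
  have -> : (1 - y) * (2 + y) / 2 = 1 - y / 2 - y ^+ 2 / 2 by field.
  by have := sqr_ge0 y; lra.
rewrite [leLHS]mulrC; apply: ler_pM => //.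
  by rewrite !mulr_ge0//; lra.
by lra.
Qed.

Lemma sign_iter_cvg (x : R) : `|x| <= 1 ->
  iter n sign_step x @[n --> \oo] --> Num.sg x.
Proof.
have pos (y : R) : 0 < y -> y <= 1 -> iter n sign_step y @[n --> \oo] -->
  (1 : R).
  move=> y0 y1; apply/cvgrPdist_le => eps eps0.
  have q1 : `|1 - y / 2| < 1 by rewrite ltr_norml; apply/andP; split; lra.
  have /cvgrPdist_le/(_ _ eps0)[N _ NP] := cvg_expr q1.
  exists N => // n /NP/=; rewrite sub0r normrN => h.
  have [_ h2] := sign_iter_pos n y0 y1.
  rewrite ger0_norm; last first.
    rewrite subr_ge0; apply: le_trans (ler_norm _) _.
    by apply: sign_iter_bound; rewrite ger0_norm// ltW.
  exact: le_trans h2 (le_trans (ler_norm _) h).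
move=> x1; have [x0|x0|->] := ltgtP x 0.
- rewrite ltr0_sg// -[x]opprK.
  under eq_cvg do rewrite sign_iterN.
  apply: cvgN; apply: pos; first by rewrite oppr_gt0.
  by rewrite -(ltr0_norm x0).
- by rewrite gtr0_sg//; apply: pos => //; rewrite -(gtr0_norm x0).
rewrite sgr0; have E n : iter n sign_step 0 = 0 :> R.
  by elim: n => //= n ->; rewrite /sign_step mul0r mul0r.
by under eq_cvg do rewrite E; exact: cvg_cst.
Qed.

End SignPolynomials.

(** * Multiplication operators carried over to [H] by [T] *)

Section Multipliers.
Context {R : realType} {Gamma : zmodType} (e : nat -> Gamma)
  (e_bij : bijective e).
Local Notation C := R[i].
Local Notation dual := (dual R Gamma).
Local Notation l2 := (l2 R Gamma).
Context (mu : {finite_measure set dual -> \bar R}) (sigma : nat -> set dual).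
Context (H : completeNormedModType C) (pi : Gamma -> {linear H -> H}).
Context (p : set dual -> {linear H -> H}) (T : H -> dual -> l2).
Context (TP : spectral_data mu e sigma pi p T).

Lemma measurable_T x : measurable_fun setT (T x).
Proof. by have [[]] := spectral_data_codom TP x. Qed.

Lemma T0 : {ae mu, forall chi, T 0 chi = 0}.
Proof.
have := spectral_data_linear TP (-1) 0 0; apply: filterS => chi.
by rewrite scaler0 addr0 => ->; rewrite scaleN1r addNr.
Qed.

Lemma TB x y : {ae mu, forall chi, T (x - y) chi = T x chi - T y chi}.
Proof.
have := spectral_data_linear TP (-1) y x; apply: filterS => chi.
by rewrite !scaleN1r addrC => ->; rewrite addrC.
Qed.

Lemma TD x y : {ae mu, forall chi, T (x + y) chi = T x chi + T y chi}.
Proof.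
by have := spectral_data_linear TP 1 x y; apply: filterS => chi;
  rewrite !scale1r.
Qed.

Lemma TZ c x : {ae mu, forall chi, T (c *: x) chi = c *: T x chi}.
Proof.
have := spectral_data_linear TP c x 0; apply: filterS2 T0 => chi ->.
by rewrite !addr0.
Qed.

Lemma T_qcomb (v : nat -> H) s :
  {ae mu, forall chi, T (qcomb v s) chi = qcomb (fun n => T (v n) chi) s}.
Proof.
elim: s => [|q s]; first by rewrite /qcomb big_nil;
  apply: filterS T0 => chi ->; rewrite big_nil.
have := spectral_data_linear TP (cratr q.2) (v q.1) (qcomb v s).
apply: filterS2 => chi h1 h2.
by rewrite /qcomb !big_cons -/(qcomb v s) h1 h2.
Qed.

Lemma measurable_rnorm_sqr (F : dual -> l2) : measurable_fun setT F ->
  measurable_fun setT (fun chi => (rnorm (F chi) ^+ 2)%:E).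
Proof.
by move=> mF; apply/measurable_EFinP; apply: measurable_funX;
  exact: measurable_rnorm.
Qed.

Lemma T_isometry_ae x F : measurable_fun setT F ->
  {ae mu, forall chi, T x chi = F chi} ->
  (\int[mu]_chi (rnorm (F chi) ^+ 2)%:E = (rnorm x ^+ 2)%:E)%E.
Proof.
move=> mF xF; rewrite -(spectral_data_isometry TP).
have mx := measurable_rnorm_sqr (measurable_T x).
have mF2 := measurable_rnorm_sqr mF.
by apply: ae_eq_integral => //; apply: filterS xF => chi ->.
Qed.

(** Boundedness keeps the product square integrable and scaling respects the fibres, so surjectivity
    of [T] makes multiplication by [f] act on [H]. *)
Lemma T_mul_exists f x c : measurable_complex f ->
  (forall chi, normc (f chi) <= c) ->
  exists z, {ae mu, forall chi, T z chi = f chi *: T x chi}.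
Proof.
move=> mf fc; apply: (spectral_data_surj TP).
have mF : measurable_fun setT (fun chi => f chi *: T x chi).
  by apply: (measurable_l2Z e_bij) => //; exact: measurable_T.
split; last first.
  have [_] := spectral_data_codom TP x; apply: filterS => chi xf i si.
  by rewrite l2_scaleE xf// mulr0.
split => //.
apply: (@le_lt_trans _ _ (\int[mu]_chi
  ((c ^+ 2)%:E * (rnorm (T x chi) ^+ 2)%:E))%E).
  apply: ge0_le_integral => //.
  - by move=> chi _; rewrite lee_fin sqr_ge0.
  - exact: measurable_rnorm_sqr.
  - apply: measurable_funeM; exact: (measurable_rnorm_sqr (measurable_T x)).
  - move=> chi _; rewrite -EFinM lee_fin rnormZ exprMn ler_wpM2r ?sqr_ge0//.
    by rewrite ler_pXn2r ?nnegrE ?normc_ge0// (le_trans _ (fc chi))// normc_ge0.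
rewrite ge0_integralZl//; last 3 first.
- exact: (measurable_rnorm_sqr (measurable_T x)).
- by move=> chi _; rewrite lee_fin sqr_ge0.
- by rewrite lee_fin sqr_ge0.
by rewrite (spectral_data_isometry TP) -EFinM ltry.
Qed.

(** Dominated convergence, the squared norms of the differences being dominated by [(c + c) ^+ 2]
    times that of [T x]. One good index for each [eps] is what membership in a closed subspace
    requires. *)
Lemma T_mul_cvg (f_ : nat -> dual -> C) f x y z c :
  (forall n, measurable_complex (f_ n)) -> measurable_complex f ->
  (forall n chi, normc (f_ n chi) <= c) -> (forall chi, normc (f chi) <= c) ->
  (forall chi, normc (f chi - f_ n chi) ^+ 2 @[n --> \oo] --> (0 : R)) ->
  (forall n, {ae mu, forall chi, T (y n) chi = f_ n chi *: T x chi}) ->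
  {ae mu, forall chi, T z chi = f chi *: T x chi} ->
  forall eps : R, 0 < eps -> exists n, rnorm (z - y n) < eps.
Proof.
move=> mf_ mf f_c fc f_f yE zE eps eps0.
have mx := measurable_T x.
pose g_ n chi := (normc (f chi - f_ n chi) ^+ 2 * rnorm (T x chi) ^+ 2)%:E.
have mfn n : measurable_complex (fun chi => f chi - f_ n chi).
  apply: measurable_complexD => //.
  rewrite (_ : (fun t => - f_ n t) = (fun t => -1 * f_ n t)).
    by apply: measurable_complexM => //; exact: measurable_complex_cst.
  by apply/funext => t; rewrite mulN1r.
have mg_ n : measurable_fun setT (g_ n).
  apply/measurable_EFinP; apply: measurable_funM.
    exact: measurable_normc_sqr.
  by apply: measurable_funX; exact: measurable_rnorm.
have g_E n : (\int[mu]_chi g_ n chi = (rnorm (z - y n) ^+ 2)%:E)%E.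
  rewrite -(@T_isometry_ae _ (fun chi => (f chi - f_ n chi) *: T x chi)).
  - by apply: eq_integral => chi _; rewrite rnormZ exprMn.
  - exact: (measurable_l2Z e_bij).
  - by have := TB z (y n); apply: filterS3 (yE n) zE => chi -> -> ->;
      rewrite scalerBl.
pose g chi := ((c + c) ^+ 2 * rnorm (T x chi) ^+ 2)%:E.
have ig : mu.-integrable setT g.
  apply/integrableP; split.
    apply/measurable_EFinP; apply: measurable_funM => //.
    by apply: measurable_funX; exact: measurable_rnorm.
  rewrite (eq_integral (fun chi =>
    ((c + c) ^+ 2)%:E * (rnorm (T x chi) ^+ 2)%:E)%E).
    rewrite ge0_integralZl//; last 3 first.
    - exact: (measurable_rnorm_sqr (measurable_T x)).
    - by move=> chi _; rewrite lee_fin sqr_ge0.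
    - by rewrite lee_fin sqr_ge0.
    by rewrite (spectral_data_isometry TP) -EFinM ltry.
  move=> chi _; have g0 : 0 <= (c + c) ^+ 2 * rnorm (T x chi) ^+ 2
    by rewrite mulr_ge0 ?sqr_ge0.
  by rewrite /g [LHS]gee0_abs.
have [|||_ _] := @dominated_convergence _ _ R mu setT measurableT g_ (cst 0%E)
  g mg_ _ _ ig _.
- exact: measurable_cst.
- apply: aeW => chi _; rewrite /g_.
  apply: cvg_EFin; first exact: nearW.
  have -> : (fine \o (fun n => (normc (f chi - f_ n chi) ^+ 2 * rnorm (T x chi)
    ^+ 2)%:E)) =
    (fun n => normc (f chi - f_ n chi) ^+ 2 * rnorm (T x chi) ^+ 2) by [].
  by rewrite -(mul0r (rnorm (T x chi) ^+ 2)); apply: cvgM => //; exact: cvg_cst.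
- apply: aeW => chi n _; rewrite /g_ /g [leLHS]gee0_abs; last first.
    by rewrite lee_fin mulr_ge0 ?sqr_ge0.
  rewrite lee_fin ler_wpM2r ?sqr_ge0//.
  have h : normc (f chi - f_ n chi) <= c + c.
    by rewrite (le_trans (le_normcD _ _))// normcN lerD.
  by rewrite ler_pXn2r ?nnegrE ?normc_ge0// (le_trans _ h)// normc_ge0.
rewrite integral0 => /fine_cvg/cvgrPdist_lt/(_ (eps ^+ 2)).
rewrite exprn_gt0// => /(_ isT)[N _ /(_ N (leqnn N))]/=.
rewrite g_E /= sub0r normrN ger0_norm ?sqr_ge0// ltr_pXn2r ?nnegrE ?rnorm_ge0
  ?(ltW eps0)//.
by move=> ?; exists N.
Qed.

End Multipliers.

Lemma cvg_indic_bigcup (R : realType) (X : Type) (F : nat -> set X) (x : X) :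
  \1_(\bigcup_(k < n) F k) x @[n --> \oo] --> (\1_(\bigcup_n F n) x : R).
Proof.
apply: cvg_near_cst; have [[k _ Fk]|nF] := pselect ((\bigcup_n F n) x).
  by exists k.+1 => // n /= kn; rewrite !indicE !mem_set//; exists k.
apply: nearW => n; rewrite !indicE !memNset// => -[k _ Fk].
by apply: nF; exists k.
Qed.

Section CharacterConj.
Context {R : realType} {Gamma : zmodType}.

(** Both sides are the inverse of [chi g], a number of modulus one. This supplies conjugates inside
    the algebra generated by the characters. *)
Lemma charN (chi : dual R Gamma) (g : Gamma) :
  chi (- g) = conjc (chi g : R[i]).
Proof.
have nz h : (chi h : R[i]) != 0 by rewrite -normr_eq0 [`|_|](char_norm chi h)
  oner_eq0.
have chi0 : (chi 0 : R[i]) = 1.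
  by apply: (mulfI (nz 0)); rewrite mulr1 -[LHS](charD chi 0 0) addr0.
apply: (mulfI (nz g)); rewrite -sqr_normc [`|_|](char_norm chi g) expr1n.
by rewrite -[LHS](charD chi g (- g)) subrr chi0.
Qed.

End CharacterConj.

(** * The algebra of multipliers of [V] *)

Section InvariantSubspace.
Context {R : realType} {Gamma : zmodType} (e : nat -> Gamma)
  (e_bij : bijective e).
Local Notation C := R[i].
Local Notation dual := (dual R Gamma).
Local Notation l2 := (l2 R Gamma).
Context (mu : {finite_measure set dual -> \bar R}) (sigma : nat -> set dual).
Context (H : completeNormedModType C) (pi : Gamma -> {linear H -> H}).
Context (p : set dual -> {linear H -> H}) (T : H -> dual -> l2).
Context (TP : spectral_data mu e sigma pi p T).
Context (V : set H) (V_inv : invariant_subspace pi V).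

Let sV : closed_subspace V. Proof. by case: V_inv. Qed.

(** Stability of [V] is expressed by a vector [y] of [V] because the product is only determined
    almost everywhere. The bound makes products of multipliers bounded and limits dominated. *)
Definition multiplier (f : dual -> C) :=
  [/\ measurable_complex f, exists c, forall chi, normc (f chi) <= c &
    forall x, V x -> exists2 y, V y &
      {ae mu, forall chi, T y chi = f chi *: T x chi}].

Lemma multiplierD f g : multiplier f -> multiplier g ->
  multiplier (fun chi => f chi + g chi).
Proof.
move=> [mf [c fc] fV] [mg [d gd] gV]; split.
- exact: measurable_complexD.
- by exists (c + d) => chi; rewrite (le_trans (le_normcD _ _))// lerD.
- move=> x Vx; have [y Vy yE] := fV x Vx; have [z Vz zE] := gV x Vx.
  exists (y + z); first by have [_ VD _] := sV; rewrite -[y]scale1r; exact: VD.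
  by have := TD TP y z; apply: filterS3 yE zE => chi -> -> ->; rewrite scalerDl.
Qed.

Lemma multiplierM f g : multiplier f -> multiplier g ->
  multiplier (fun chi => f chi * g chi).
Proof.
move=> [mf [c fc] fV] [mg [d gd] gV]; split.
- exact: measurable_complexM.
- by exists (c * d) => chi; rewrite normcM ler_pM// normc_ge0.
- move=> x Vx; have [z Vz zE] := gV x Vx; have [y Vy yE] := fV z Vz.
  by exists y => //; apply: filterS2 yE zE => chi -> ->; rewrite scalerA.
Qed.

Lemma multiplier_cst c : multiplier (fun=> c).
Proof.
split; [exact: measurable_complex_cst|by exists (normc c)|].
move=> x Vx; exists (c *: x); first exact: (closed_subspaceZ _ sV).
exact: (TZ TP).
Qed.

Lemma multiplier_char g : multiplier (fun chi => chi g).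
Proof.
split; first exact: measurable_eval.
  by exists 1 => chi; rewrite -lecR -normr_normc char_norm.
move=> x Vx; exists (pi g x); first by case: V_inv => _; exact.
exact: (spectral_data_rep TP).
Qed.

Lemma multiplier_lim (f_ : nat -> dual -> C) f c :
  (forall n, multiplier (f_ n)) -> measurable_complex f ->
  (forall n chi, normc (f_ n chi) <= c) -> (forall chi, normc (f chi) <= c) ->
  (forall chi, normc (f chi - f_ n chi) ^+ 2 @[n --> \oo] --> (0 : R)) ->
  multiplier f.
Proof.
move=> f_V mf f_c fc f_f; split; [by []|by exists c|move=> x Vx].
have [z zE] := T_mul_exists e_bij TP x mf fc; exists z => //.
have /choice[y yP] : forall n, exists y, V y /\ {ae mu, forall chi, T y chi =
  f_ n chi *: T x chi}.
  by move=> n; have [_ _ /(_ _ Vx)[y Vy yE]] := f_V n; exists y.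
apply: (closed_subspace_approx sV) => eps eps0.
have mf_ n : measurable_complex (f_ n) by have [] := f_V n.
have yE n : {ae mu, forall chi, T (y n) chi = f_ n chi *: T x chi}
  by have [] := yP n.
have [n nP] := T_mul_cvg e_bij TP mf_ mf f_c fc f_f yE zE eps0.
by exists (y n) => //; have [] := yP n.
Qed.

Lemma normc_realB (a b : R) : normc (a%:C - b%:C) ^+ 2 = (a - b) ^+ 2.
Proof. by rewrite -rmorphB normc_real real_normK ?num_real. Qed.

Lemma cvg_sqr_dist0 (a : nat -> R) (b : R) : a @ \oo --> b ->
  normc (b%:C - (a n)%:C) ^+ 2 @[n --> \oo] --> (0 : R).
Proof.
move=> ab; have h : b - a n @[n --> \oo] --> (0 : R).
  by rewrite -(subrr b); apply: cvgB => //; exact: cvg_cst.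
rewrite (_ : (fun n => _) = (fun n => (b - a n) * (b - a n))).
  by have hh := cvgM h h; rewrite mul0r in hh; exact: hh.
by apply/funext => n; rewrite normc_realB expr2.
Qed.

Definition real_multiplier (u : dual -> R) :=
  multiplier (fun chi => (u chi)%:C).

Lemma real_multiplierD u v : real_multiplier u -> real_multiplier v ->
  real_multiplier (fun chi => u chi + v chi).
Proof.
move=> mu_ mv; rewrite /real_multiplier; under eq_fun do rewrite rmorphD.
exact: multiplierD.
Qed.

Lemma real_multiplierM u v : real_multiplier u -> real_multiplier v ->
  real_multiplier (fun chi => u chi * v chi).
Proof.
move=> mu_ mv; rewrite /real_multiplier; under eq_fun do rewrite rmorphM.
exact: multiplierM.
Qed.

Lemma real_multiplier_cst c : real_multiplier (fun=> c).
Proof. exact: multiplier_cst. Qed.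

Lemma real_multiplierB u v : real_multiplier u -> real_multiplier v ->
  real_multiplier (fun chi => u chi - v chi).
Proof.
move=> mu_ mv; under eq_fun do rewrite -mulN1r.
apply: real_multiplierD => //; apply: real_multiplierM => //.
exact: real_multiplier_cst.
Qed.

Lemma real_multiplier_lim (u_ : nat -> dual -> R) (u : dual -> R) :
  (forall n, real_multiplier (u_ n)) -> measurable_fun setT u ->
  (forall n chi, `|u_ n chi| <= 1) -> (forall chi, `|u chi| <= 1) ->
  (forall chi, u_ ^~ chi @ \oo --> u chi) -> real_multiplier u.
Proof.
move=> u_V mu_ u_1 u1 u_u.
apply: (multiplier_lim u_V (c := 1)).
- exact: measurable_complex_real.
- by move=> n chi; rewrite normc_real.
- by move=> chi; rewrite normc_real.
- by move=> chi; exact: cvg_sqr_dist0.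
Qed.

Lemma real_multiplier_sgn u :
  real_multiplier u -> (forall chi, `|u chi| <= 1) ->
  real_multiplier (fun chi => Num.sg (u chi)).
Proof.
move=> uV u1; have mu_ : measurable_fun setT u by case: uV => -[].
apply: (real_multiplier_lim (u_ := fun n chi => iter n sign_step (u chi))).
- elim=> //= n IH; rewrite /sign_step.
  under eq_fun do rewrite expr2.
  apply: real_multiplierM; last exact: real_multiplier_cst.
  apply: real_multiplierM => //; apply: real_multiplierB;
    first exact: real_multiplier_cst.
  exact: real_multiplierM.
- apply: (@measurable_fun_cvg _ _ _ _ (fun n chi => iter n sign_step (u chi))).
    elim=> //= n IH; rewrite /sign_step; apply: measurable_funM => //.
    apply: measurable_funM => //; apply: measurable_funB => //.
    exact: measurable_funX.
  by move=> chi _; exact: sign_iter_cvg.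
- by move=> n chi; exact: sign_iter_bound.
- by move=> chi; rewrite normr_sg; case: eqP => //= _; rewrite ler01.
- by move=> chi; exact: sign_iter_cvg.
Qed.

Lemma real_multiplier_lt u (c : R) : real_multiplier u ->
  real_multiplier \1_[set chi | u chi < c].
Proof.
move=> uV; have [_ [b ub] _] := uV.
(* Dividing [u - c] by [k] brings it into [-1, 1], where the sign polynomials converge; the [+ 1]
   keeps [k] positive. *)
pose k := b + `|c| + 1.
have b0 : 0 <= b by rewrite (le_trans _ (ub point))// normc_ge0.
have k0 : 0 < k by rewrite /k; have := normr_ge0 c; lra.
pose w chi := (u chi - c) / k.
have wV : real_multiplier w.
  apply: real_multiplierM; last exact: real_multiplier_cst.
  by apply: real_multiplierB => //; exact: real_multiplier_cst.
have w1 chi : `|w chi| <= 1.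
  rewrite normrM normfV (gtr0_norm k0) ler_pdivrMr// mul1r.
  rewrite (le_trans (ler_normB _ _))//; have := ub chi; rewrite normc_real /k;
    lra.
have sV_ := real_multiplier_sgn wV w1.
(* For a sign [s], the value of [(s * s - s) / 2] is 1 at [s = -1] and 0 at [s = 0] and [s = 1],
   which gives the strict inequality. *)
have -> : \1_[set chi | u chi < c] =
    (fun chi => (Num.sg (w chi) * Num.sg (w chi) - Num.sg (w chi)) / 2) :>
      (dual -> R).
  apply/funext => chi; rewrite indicE.
  have swE : Num.sg (w chi) = Num.sg (u chi - c).
    by rewrite /w sgrM sgrV (gtr0_sg k0) mulr1.
  rewrite swE; case: (ltgtP (u chi) c) => uc.
  - by rewrite mem_set// ltr0_sg ?subr_lt0//= mulrNN mulr1 opprK -mulr2n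
      divff// pnatr_eq0.
  - rewrite memNset/=; last by rewrite ltNge (ltW uc).
    by rewrite gtr0_sg ?subr_gt0// mulr1 subrr mul0r.
  - by rewrite memNset/= uc ?ltxx// subrr sgr0 mulr0 subrr mul0r.
apply: real_multiplierM; last exact: real_multiplier_cst.
by apply: real_multiplierB => //; exact: real_multiplierM.
Qed.

Lemma real_multiplier_indic (E : set dual) : measurable E ->
  real_multiplier \1_E.
Proof.
move=> mE; pose D := [set F : set dual | measurable F /\ real_multiplier \1_F].
suff [] : D E by [].
have e_surj g : exists n, e n = g by have [h _ he] := e_bij; exists (h g).
have := measurable_dual_balls e_surj mE; apply.
have D0 : D set0.
  by split=> //; rewrite indic0; exact: real_multiplier_cst.
have DC F : D F -> D (~` F).
  move=> [mF FV]; split; first exact: measurableC.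
  rewrite (_ : \1_(~` F) = (fun chi => 1 - \1_F chi) :> (dual -> R)).
    by apply: real_multiplierB => //; exact: real_multiplier_cst.
  by apply/funext => chi; rewrite !indicE in_setC; case: (chi \in F);
    rewrite /= ?subrr ?subr0.
have DI F G : D F -> D G -> D (F `&` G).
  move=> [mF FV] [mG GV]; split; first exact: measurableI.
  rewrite indicI; exact: real_multiplierM.
have DU F G : D F -> D G -> D (F `|` G).
  by move=> DF DG; rewrite -[F `|` G]setCK setCU;
    exact: (DC _ (DI _ _ (DC _ DF) (DC _ DG))).
split; first split.
- exact: D0.
- by move=> F DF; rewrite setTD; exact: DC.
(* Finite unions come from complements and intersections; their indicators converge pointwise to
   that of the countable union. *)
- move=> F DF; pose G n := \bigcup_(i < n) F i.
  have DG n : D (G n).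
    elim: n => [|n IH]; first by rewrite /G II0 bigcup_set0.
    rewrite /G (_ : `I_n.+1 = `I_n `|` [set n]) ?bigcup_setU ?bigcup_set1;
      first exact: DU.
    by rewrite IIS.
  split; first by apply: bigcup_measurable => n _; have [] := DF n.
  apply: (real_multiplier_lim (u_ := fun n => \1_(G n))).
  + by move=> n; have [] := DG n.
  + apply: measurable_indic; apply: bigcup_measurable => n _;
      by have [] := DF n.
  + by move=> n chi; rewrite indicE; case: (_ \in _);
      rewrite ?normr1 ?normr0 ?ler01.
  + by move=> chi; rewrite indicE; case: (_ \in _);
      rewrite ?normr1 ?normr0 ?ler01.
  + by move=> chi; exact: cvg_indic_bigcup.
- move=> _ [i [q [r [r0 ->]]]].
  have -> : dual_ball e i q r = [set chi | normc (chi (e i) - cratr q) ^+ 2 < r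
    ^+ 2].
    by apply/seteqP; split => chi /=;
      rewrite /dual_ball/= ltr_pXn2r ?nnegrE ?normc_ge0// ltW.
  have uV : real_multiplier (fun chi => normc (chi (e i) - cratr q) ^+ 2).
    (* The squared modulus is a number times its conjugate, and the conjugate of [chi (e i)] is the
       character value at [- e i]. *)
    rewrite /real_multiplier (_ : (fun chi => _) =
        (fun chi : dual => (chi (e i) + - cratr q) * (chi (- e i) +
          - conjc (cratr q)))).
      apply: multiplierM; apply: multiplierD; try exact: multiplier_char.
      - exact: multiplier_cst.
      - exact: multiplier_cst.
    apply/funext => chi; rewrite charN.
    have -> : (normc (chi (e i) - cratr q) ^+ 2)%:C = `|(chi (e i) : C) - cratr
      q| ^+ 2.
      by rewrite normr_normc -rmorphXn.
    by rewrite sqr_normc [conjc _]rmorphB.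
  split; last exact: real_multiplier_lt.
  have mn : measurable_fun setT (fun chi : dual => normc (chi (e i) - cratr q)
    ^+ 2).
    by case: uV => -[].
  have := mn measurableT _ (measurable_itv `]-oo, r ^+ 2[).
  by rewrite setTI preimage_itvNyo.
Qed.

End InvariantSubspace.

(** * Subspaces defined by range functions *)

Section SectionSpaces.
Context {R : realType} {Gamma : zmodType} (e : nat -> Gamma)
  (e_bij : bijective e).
Local Notation C := R[i].
Local Notation dual := (dual R Gamma).
Local Notation l2 := (l2 R Gamma).
Context (mu : {finite_measure set dual -> \bar R}) (sigma : nat -> set dual).
Context (H : completeNormedModType C) (pi : Gamma -> {linear H -> H}).
Context (p : set dual -> {linear H -> H}) (T : H -> dual -> l2).
Context (TP : spectral_data mu e sigma pi p T).

(* The infimum over n of |T x - T (y n)|^2 has integral 0, so that no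
   subsequence has to be extracted. *)
Lemma T_approx (y : nat -> H) x :
  (forall eps : R, 0 < eps -> exists n, rnorm (x - y n) < eps) ->
  {ae mu, forall chi, forall eps : R, 0 < eps ->
    exists n, rnorm (T x chi - T (y n) chi) < eps}.
Proof.
move=> yx.
pose g n chi := (rnorm (T x chi - T (y n) chi) ^+ 2)%:E.
have mT z : measurable_fun setT (T z) by exact: (measurable_T TP).
have mB n : measurable_fun setT (fun chi => T x chi - T (y n) chi).
  exact: (measurable_l2B e_bij).
have mg n : measurable_fun setT (g n) by exact: measurable_rnorm_sqr.
have g0 n chi : (0 <= g n chi)%E by rewrite lee_fin sqr_ge0.
have gE n : (\int[mu]_chi g n chi = (rnorm (x - y n) ^+ 2)%:E)%E.
  by apply: (T_isometry_ae TP) => //; exact: (TB TP).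
pose G chi := einfs (g ^~ chi) 0.
have mG : measurable_fun setT G by exact: measurable_fun_einfs.
have G0 chi : (0 <= G chi)%E.
  by apply: le_ereal_inf_tmp => _ [n _ <-]; exact: g0.
have Gg n chi : (G chi <= g n chi)%E by apply: ereal_inf_lbound; exists n.
have intG : (\int[mu]_chi G chi = 0)%E.
  apply/eqP; rewrite eq_le; apply/andP; split; last by apply: integral_ge0.
  apply/lee_addgt0Pr => eps eps0; rewrite add0e.
  have [|n nP] := yx (Num.sqrt eps); first by rewrite sqrtr_gt0.
  apply: (@le_trans _ _ (\int[mu]_chi g n chi)%E); first exact: ge0_le_integral.
  rewrite gE lee_fin -[leRHS](@sqr_sqrtr _ eps) ?(ltW eps0)//.
  by rewrite ler_pXn2r ?nnegrE ?rnorm_ge0 ?sqrtr_ge0// ltW.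
have /(ae_eq_integral_abs mu measurableT mG) : (\int[mu]_(chi in setT) `|G chi|
  = 0)%E.
  by rewrite -[RHS]intG; apply: eq_integral => chi _; rewrite gee0_abs.
apply: filterS => chi /(_ I) Gchi eps eps0.
have : (G chi < (eps ^+ 2)%:E)%E by rewrite Gchi lte_fin exprn_gt0.
move=> /ereal_inf_lt[_ [n _ <-]]; rewrite lte_fin => h; exists n.
by rewrite -(@ltr_pXn2r _ 2)// ?nnegrE ?rnorm_ge0// ltW.
Qed.

Definition section_space (J : dual -> set l2) : set H :=
  [set f | {ae mu, forall chi, J chi (T f chi)}].

Lemma section_space_approx (J : dual -> set l2) (f : H) (y : nat -> H) :
  range_function J ->
  (forall n, section_space J (y n)) ->
  (forall eps : R, 0 < eps -> exists n, rnorm (f - y n) < eps) ->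
  section_space J f.
Proof.
move=> sJ Jy fy; have := ae_foralln Jy;
  apply: filterS2 (T_approx fy) => chi h1 h2.
apply: (closed_subspace_approx (sJ chi)) => eps eps0.
by have [n nP] := h1 _ eps0; exists (T (y n) chi).
Qed.

Lemma section_space_subspace (J : dual -> set l2) : range_function J ->
  closed_subspace (section_space J).
Proof.
move=> sJ; split.
- by apply: filterS (T0 TP) => chi ->; have [] := sJ chi.
- move=> c x y Jx Jy; have := spectral_data_linear TP c x y.
  by apply: filterS3 Jx Jy => chi Jx Jy ->; have [_ JD _] := sJ chi; exact: JD.
move=> f /closure_rnormP cf.
have /choice[y yP] : forall n : nat, exists y, section_space J y /\
  rnorm (f - y) < n.+1%:R^-1.
  move=> n; have n0 : 0 < n.+1%:R^-1 :> R by rewrite invr_gt0.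
  by have [y Jy fy] := cf _ n0; exists y.
apply: (section_space_approx (y := y)) => // [n|eps eps0];
  first by have [] := yP n.
have [N _ NP] := near_infty_natSinv_lt (PosNum eps0).
by exists N; have [_ /lt_trans] := yP N; apply; exact: NP (leqnn N).
Qed.

Lemma section_space_invariant (J : dual -> set l2) : range_function J ->
  invariant_subspace pi (section_space J).
Proof.
move=> sJ; split; first exact: section_space_subspace.
move=> g x Jx; have := spectral_data_rep TP g x.
by apply: filterS2 Jx => chi Jx ->; exact: (closed_subspaceZ _ (sJ chi)).
Qed.

Section Selection.
Context (V : set H) (V_inv : invariant_subspace pi V).

Let sV : closed_subspace V. Proof. by case: V_inv. Qed.

Lemma invariant_indic (E : set dual) x : measurable E -> V x ->
  exists2 y, V y & {ae mu, forall chi, T y chi = (\1_E chi)%:C *: T x chi}.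
Proof.
by move=> /(real_multiplier_indic e_bij TP V_inv)[_ _ h] Vx; exact: h.
Qed.

(** The error splits in two. Outside [S N] it is the part of [T f] cut off, which dominated
    convergence makes small; on [S N] it is pointwise below [delta], which the finite measure turns
    into a small norm. *)
Lemma invariant_ae_closure (v : nat -> H) f : (forall n, V (v n)) ->
  {ae mu, forall chi, closure (range (fun n => T (v n) chi)) (T f chi)} -> V f.
Proof.
move=> Vv fv; apply: (closed_subspace_approx sV) => eps eps0.
have e2 : 0 < eps / 2 by rewrite divr_gt0.
pose m := fine (mu setT).
have m0 : 0 <= m by rewrite fine_ge0.
have muE : mu setT = m%:E by rewrite fineK// fin_num_measure.
(* The integral of [delta ^+ 2] is then at most [(eps / 2) ^+ 2], because [m <= (m + 1) ^+ 2]. *)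
pose delta := eps / 2 / (m + 1).
have delta0 : 0 < delta by rewrite divr_gt0// ltr_wpDl.
have mT z : measurable_fun setT (T z) by exact: (measurable_T TP).
pose U n := [set chi | rnorm (T f chi - T (v n) chi) < delta].
have mU n : measurable (U n).
  have mr : measurable_fun setT (fun chi => rnorm (T f chi - T (v n) chi)).
    by apply: measurable_rnorm; exact: (measurable_l2B e_bij).
  have := mr measurableT _ (measurable_itv `]-oo, delta[).
  by rewrite setTI preimage_itvNyo.
pose S N := \bigcup_(n < N) U n.
have mS N : measurable (S N) by apply: bigcup_measurable.
(* y glues the v n, n < N, along the first n such that U n contains chi. *)
have step N : exists y, V y /\ {ae mu, forall chi,
    (S N chi -> rnorm (T f chi - T y chi) < delta) /\
      (~ S N chi -> T y chi = 0)}.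
  elim: N => [|N [y [Vy yE]]].
    exists 0; split; first by case: sV.
    by apply: filterS (T0 TP) => chi ->; split => // -[].
  have mD : measurable (U N `\` S N) by exact: measurableD.
  have [z Vz zE] := invariant_indic mD (Vv N).
  exists (y + z); split.
    by have [_ VD _] := sV; rewrite -[y]scale1r; exact: VD.
  have := TD TP y z; apply: filterS3 yE zE => chi [yS yN] zE ->.
  rewrite zE indicE; split.
    have [Schi _|nS] := pselect (S N chi).
      by rewrite memNset ?scale0r ?addr0; [exact: yS|case].
    move=> [k /=]; rewrite ltnS leq_eqVlt => /orP[/eqP->|kN] Uk.
      by rewrite mem_set// scale1r yN// add0r.
    by exfalso; apply: nS; exists k.
  move=> nS; have nSN : ~ S N chi.
    by move=> [k kN Uk]; apply: nS; exists k => //=; exact: ltnW.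
  rewrite yN// add0r memNset ?scale0r// => -[UN _].
  by apply: nS; exists N => /=.
have /choice[y yP] := step.
pose S' := \bigcup_n U n.
have mS' : measurable S' by exact: bigcupT_measurable.
have ind1 (E : set dual) chi : normc (\1_E chi)%:C <= 1 :> R.
  by rewrite normc_real indicE; case: (_ \in _); rewrite ?normr1 ?normr0 ?ler01.
have mind (E : set dual) : measurable E -> measurable_complex (fun chi =>
  (\1_E chi : R)%:C).
  by move=> mE; apply: measurable_complex_real; exact: measurable_indic.
(* [h N] is [f] cut down to [S N]. It only mediates between [f] and the glued vector [y N], which is
   the one known to lie in [V]. *)
have /choice[h hE] : forall N, exists h, {ae mu, forall chi, T h chi =
  (\1_(S N) chi)%:C *: T f chi}.
  move=> N; exact: (T_mul_exists e_bij TP f (mind _ (mS N)) (ind1 (S N))).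
have fE : {ae mu, forall chi, T f chi = (\1_S' chi)%:C *: T f chi}.
  apply: filterS fv => chi /closure_rnormP/(_ _ delta0)[_ [n _ <-] nP].
  by rewrite indicE mem_set ?scale1r//; exists n.
have lim chi : normc ((\1_S' chi : R)%:C - (\1_(S N) chi)%:C) ^+ 2 @[N --> \oo]
  --> (0 : R).
  by apply: cvg_sqr_dist0; exact: cvg_indic_bigcup.
have [N NP] := T_mul_cvg e_bij TP (fun n => mind _ (mS n)) (mind _ mS')
  (fun n => ind1 (S n)) (ind1 S') lim hE fE e2.
have [VyN yE] := yP N; exists (y N) => //.
rewrite (le_lt_trans (ler_rnormB f (h N) (y N)))// (splitr eps) ltr_leD//.
rewrite -(@ler_pXn2r _ 2)// ?nnegrE ?rnorm_ge0 ?(ltW e2)//.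
rewrite -lee_fin -(spectral_data_isometry TP).
apply: (@le_trans _ _ (\int[mu]_(chi in setT) (delta ^+ 2)%:E)%E).
  apply: ae_ge0_le_integral => //.
  - by move=> chi _; rewrite lee_fin sqr_ge0.
  - exact: measurable_rnorm_sqr.
  - by move=> chi _; rewrite lee_fin sqr_ge0.
  have := TB TP (h N) (y N); apply: filterS3 yE (hE N) => chi [y1 y2] h1 h2 _.
  rewrite lee_fin ler_pXn2r ?nnegrE ?rnorm_ge0 ?(ltW delta0)// h2 h1 indicE.
  have [Schi|nS] := pselect (S N chi).
    by rewrite mem_set// scale1r ltW// y1.
  by rewrite memNset// scale0r y2// subrr rnorm0 ltW.
rewrite integral_cst//= muE -EFinM lee_fin.
have m1 : 0 < m + 1 by rewrite ltr_wpDl.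
rewrite /delta exprMn -mulrA ler_piMr ?sqr_ge0// exprVn mulrC ler_pdivrMr
  ?exprn_gt0// mul1r.
by rewrite sqrrD mulr1 expr1n; have := sqr_ge0 m; lra.
Qed.

End Selection.

End SectionSpaces.

(** * Countable sets and dense sequences *)

Lemma countable_sub_range (X : Type) (x0 : X) (A : set X) : countable A ->
  exists a : nat -> X, A `<=` range a.
Proof.
move=> /pfcard_geP[->|[f]]; first by exists (fun=> x0).
by exists f => x Ax; have [n _ <-] := 'surj_f Ax; exists n.
Qed.

(** A dense sequence of [E] may miss [M], so for each of its points and each radius [1 / (k + 1)] a
    point of [M] within that radius is selected, with 0 as default if there is none. *)
Lemma exists_dense_seq (R : realType) (E : normedModType R[i]) (M : set E) :
  separable E -> M 0 ->
  exists v : nat -> E, (forall n, M (v n)) /\ M `<=` closure (range v).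
Proof.
move=> [D cD dD] M0; have [d dP] := countable_sub_range 0 cD.
have /choice[w wP] : forall nk : nat * nat, exists y, M y /\
    ((exists2 x, M x & rnorm (d nk.1 - x) < nk.2.+1%:R^-1) ->
     rnorm (d nk.1 - y) < nk.2.+1%:R^-1).
  move=> nk; have [[x Mx xP]|no] :=
    pselect (exists2 x, M x & rnorm (d nk.1 - x) < nk.2.+1%:R^-1).
    by exists x.
  by exists 0.
exists (fun m => w (odflt (0%N, 0%N) (unpickle m))); split.
  by move=> m; have [] := wP (odflt (0%N, 0%N) (unpickle m)).
move=> x Mx; apply/closure_rnormP => eps eps0.
have e2 : 0 < eps / 2 by rewrite divr_gt0.
have [k _ /(_ k (leqnn k)) kP] := near_infty_natSinv_lt (PosNum e2).
have k0 : 0 < k.+1%:R^-1 :> R by rewrite invr_gt0.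
have /closure_rnormP/(_ _ k0)[y Dy xy] : closure D x.
  move=> B; rewrite nbhsE => -[B' [oB' B'x] B'B].
  by have [y [B'y Dy]] := dD B' (ex_intro _ x B'x) oB'; exists y; split=> //;
    exact: B'B.
have [n _ dn] := dP _ Dy; subst y; have [Mw wd] := wP (n, k).
exists (w (n, k)); first by exists (pickle (n, k)); rewrite // pickleK.
rewrite (le_lt_trans (ler_rnormB x (d n) _))// (splitr eps) ltrD//.
  exact: lt_trans xy kP.
by apply: lt_trans kP; apply: wd; exists x; rewrite // rnormB.
Qed.

(** * Measurability of the projections onto closed spans *)

Section DistanceMeasurability.
Context {R : realType} {I : choiceType} (e : nat -> I) (e_bij : bijective e).
Context {d : measure_display} {X : measurableType d}.
Local Notation C := R[i].
Local Notation l2 := (l2 R I).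
Local Notation dot := (@l2_dot R I).
Context (v : nat -> X -> l2) (mv : forall n, measurable_fun setT (v n)).
Let J t := closed_span (range (fun n => v n t)).

Lemma l2_dot_delta (a : l2) i : dot a (delta i) = a i.
Proof.
have [g eg ge] := e_bij.
apply: (ccvg_unique (dot_cvg e_bij a (delta i))).
have E1 k : (a (e k) : C) * conjc (delta i (e k) : C) = if k == g i then a i
  else 0.
  rewrite deltaE; case: (k =P g i) => [->|ki];
    first by rewrite ge eqxx conjc1 mulr1.
  by case: eqP => [ek|_]; [case: ki; rewrite -ek eg|rewrite conjc0 mulr0].
have E n : (g i < n)%N -> dotn e n a (delta i) = a i.
  move=> gn; rewrite /dotn (eq_bigr (fun k : 'I_n => _) (fun k _ => E1 k))
    (bigD1 (Ordinal gn))//= eqxx.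
  rewrite big1 ?addr0// => k kg; case: eqP => // ki.
  by case/eqP: kg; apply/val_inj.
by split; apply: cvg_near_cst; exists (g i).+1 => // n /= /E ->.
Qed.

Lemma measurable_dist x :
  measurable_fun setT (fun t => rnorm (x - orth_proj dot (J t) x)).
Proof.
pose h n t := rnorm (x - qcomb (v ^~ t) (odflt [::] (unpickle n))).
rewrite (_ : (fun t => _) = (fun t => infs (h ^~ t) 0)).
  apply: measurable_fun_infs => [t _|n].
    by exists 0 => _ [n _ <-]; exact: rnorm_ge0.
  apply: measurable_rnorm; apply: (measurable_l2B e_bij);
    first exact: measurable_cst.
  exact: (measurable_l2_qcomb e_bij (v := fun t => v ^~ t) _ mv).
apply/funext => t; rewrite (orth_proj_dist_qcomb e_bij); congr (inf _).
apply/seteqP; split => [_ [s _ <-]|_ [n _ <-]].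
  by exists (pickle s) => //; rewrite /h pickleK.
by exists (odflt [::] (unpickle n)).
Qed.

Lemma measurable_rnorm_orth_proj x :
  measurable_fun setT (fun t => rnorm (orth_proj dot (J t) x) ^+ 2).
Proof.
have sJ t : closed_subspace (J t) by exact: closed_span_subspace.
under eq_fun do rewrite (rnorm_orth_proj e_bij x (sJ _)).
by apply: measurable_funB; [exact: measurable_cst|apply: measurable_funX;
  exact: measurable_dist].
Qed.

Lemma measurable_Re_orth_proj_dot x y :
  measurable_fun setT (fun t => complex.Re (dot (orth_proj dot (J t) x) y)).
Proof.
have sJ t : closed_subspace (J t) by exact: closed_span_subspace.
rewrite (_ : (fun t => _) =
  (fun t => (rnorm (orth_proj dot (J t) (x + y)) ^+ 2 -
    rnorm (orth_proj dot (J t) x) ^+ 2 - rnorm (orth_proj dot (J t) y) ^+ 2) /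
      2)).
  apply: measurable_funM => //.
  by apply: measurable_funB; [apply: measurable_funB|];
    exact: measurable_rnorm_orth_proj.
apply/funext => t; rewrite (dot_orth_proj e_bij x y (sJ t)).
have := orth_proj_linear e_bij 1 x y (sJ t); rewrite !scale1r => ->.
exact: (Re_dotE e_bij).
Qed.

Lemma measurable_orth_proj_dot x y :
  measurable_complex (fun t => dot (orth_proj dot (J t) x) y).
Proof.
split; first exact: measurable_Re_orth_proj_dot.
under eq_fun do rewrite (Im_dotE e_bij).
exact: measurable_Re_orth_proj_dot.
Qed.

End DistanceMeasurability.

(** * Functions measurable for the completed sigma-algebra *)

Section Completion.
Context {R : realType} {d : measure_display} {X : measurableType d}.
Context (mu : {measure set X -> \bar R}).
Local Notation C := R[i].

Lemma measurable_completed (A : set X) : measurable A ->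
  completed_algebra_gen mu A.
Proof.
by move=> mA; exists A => //; exists set0;
  [exact: negligible_set0|rewrite setU0].
Qed.

(* N' is arbitrary above N so that countably many functions can share one null
   set. *)
Lemma completed_real_restrict (f : X -> R) :
  (forall r : rat, completed_algebra_gen mu [set t | ratr r < f t]) ->
  exists N, [/\ measurable N, mu N = 0%E &
    forall N', measurable N' -> N `<=` N' ->
    measurable_fun setT (fun t => \1_(~` N') t * f t)].
Proof.
move=> mf.
have /choice[A AP] : forall r : rat, exists A, measurable A /\ exists N,
    [/\ measurable N, mu N = 0%E & forall t, ~ N t -> (ratr r < f t <-> A t)].
  move=> r; have [A mA [M [N [mN muN MN]] AM]] := mf r; exists A; split=> //.
  exists N; split=> // t nN.
  have -> : (ratr r < f t : Prop) = [set t | ratr r < f t] t by [].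
  by rewrite -AM; split => [[//|/MN]|]; [|left].
have /choice[N NP] : forall r, exists N,
    [/\ measurable N, mu N = 0%E & forall t, ~ N t -> (ratr r < f t <-> A r t)].
  by move=> r; have [_ [N NP]] := AP r; exists N.
pose Nn n := N (odflt 0 (unpickle n)).
exists (\bigcup_n Nn n); split.
- by apply: bigcupT_measurable => n; have [] := NP (odflt 0 (unpickle n)).
- apply/negligibleP; first by apply: bigcupT_measurable => n;
    have [] := NP (odflt 0 (unpickle n)).
  apply: negligible_bigcup => n; have [mN muN _] := NP (odflt 0 (unpickle n)).
  exact/negligibleP.
move=> N' mN' NN'; apply: measurable_fun_openP => c.
have nN r t : ~ N' t -> ~ N r t.
  by move=> nN' Nt; apply: nN'; apply: NN'; exists (pickle r) => //;
    rewrite /Nn pickleK.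
(* Off [N'], [c < f t] holds exactly when a rational [r] fits strictly between, and there
   [ratr r < f t] is membership in the measurable set [A r]. *)
pose B := \bigcup_(r : rat) (if c < ratr r then A r else set0).
have mB : measurable B.
  apply: countable_bigcupT_measurable => [|r]; first exact: countableP.
  by case: ifP => _ //; have [] := AP r.
have mBN : measurable (B `&` ~` N') by apply: measurableI => //;
  exact: measurableC.
have BE t : ~ N' t -> (c <= f t /\ ~ B t -> f t = c) /\ (B t -> c < f t).
  move=> nN'; split.
    move=> [cf nB]; apply/eqP; rewrite eq_le cf andbT leNgt; apply/negP => cft.
    have [q] := rat_in_itvoo cft; rewrite in_itv/= => /andP[cq qf].
    apply: nB; exists q => //; rewrite cq; have [_ _ <- //] := NP q.
    exact: nN.
  move=> [r _]; case: ifP => // cr; have [_ _ h] := NP r.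
  by move=> /h; move=> /(_ (nN r t nN')); exact: lt_trans.
have fE t : ~ N' t -> (c < f t <-> B t).
  move=> nN'; have [h1 h2] := BE t nN'; split=> // cft.
  apply: contrapT => nB; have := h1 (conj (ltW cft) nB) => fc.
  by rewrite fc ltxx in cft.
(* The restricted function vanishes on [N'], so [N'] belongs to the set of points above [c] exactly
   when [c] is negative. *)
have [c0|c0] := ltP c 0.
  rewrite (_ : [set _ | _] = (B `&` ~` N') `|` N'); first exact: measurableU.
  apply/seteqP; split => [t /=|t [[Bt nN']|N't]] /=.
  - have [N't _|nN'] := pselect (N' t); first by right.
    by rewrite indicE mem_set// mul1r => /(fE t nN'); left.
  - by rewrite indicE mem_set// mul1r; exact/fE.
  - by rewrite indicE memNset ?mul0r// => /(_ N't).
rewrite (_ : [set _ | _] = B `&` ~` N') //.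
apply/seteqP; split => [t /=|t [Bt nN']] /=.
  have [N't|nN'] := pselect (N' t).
    by rewrite indicE memNset ?mul0r ?ltNge ?c0// => /(_ N't).
  by rewrite indicE mem_set// mul1r => /(fE t nN').
by rewrite indicE mem_set// mul1r; exact/fE.
Qed.

End Completion.

(** * Measurable sections of a range function *)

Section RangeFunctions.
Context {R : realType} {Gamma : zmodType} (e : nat -> Gamma)
  (e_bij : bijective e).
Local Notation C := R[i].
Local Notation dual := (dual R Gamma).
Local Notation l2 := (l2 R Gamma).
Local Notation P K chi := (orth_proj (@l2_dot R Gamma) (K chi)).
Context (mu : {finite_measure set dual -> \bar R}).

Lemma measurable_complex_mu (h : dual -> C) : measurable_complex h ->
  mu_measurable mu h.
Proof.
move=> mh U oU; apply: measurable_completed.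
exact: (measurable_complex_preimage mh oU).
Qed.

Lemma mu_measurable_restrict (h : dual -> C) : mu_measurable mu h ->
  exists N, [/\ measurable N, mu N = 0%E &
    forall N', measurable N' -> N `<=` N' ->
    measurable_complex (fun chi => (\1_(~` N') chi)%:C * h chi)].
Proof.
move=> mh.
have [|N1 [mN1 muN1 h1]] := @completed_real_restrict _ _ _ mu (fun chi =>
  complex.Re (h chi)).
  move=> r; apply: (mh [set z | ratr r < complex.Re z]);
    apply: (@open_lipschitz_gt _ C^o).
  by move=> x y; rewrite -raddfB; exact: ler_Re_normc.
have [|N2 [mN2 muN2 h2]] := @completed_real_restrict _ _ _ mu (fun chi =>
  complex.Im (h chi)).
  move=> r; apply: (mh [set z | ratr r < complex.Im z]);
    apply: (@open_lipschitz_gt _ C^o).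
  by move=> x y; rewrite -raddfB; exact: ler_Im_normc.
exists (N1 `|` N2); split; first exact: measurableU.
  by apply/negligibleP; [exact: measurableU|apply: negligibleU;
    exact/negligibleP].
move=> N' mN' NN'; split.
  under eq_fun do rewrite cReM/= mul0r subr0.
  by apply: h1 => // t ?; apply: NN'; left.
under eq_fun do rewrite cImM/= mul0r addr0.
by apply: h2 => // t ?; apply: NN'; right.
Qed.

(** The coordinates of the projected [delta (e n)] are its products with the [delta (e j)], each
    Borel after removal of a null set. Setting everything to zero on the union of these countably
    many null sets gives Borel sections; the bound 1 makes them square integrable for a finite
    measure. *)
Lemma range_function_sections (K : dual -> set l2) :
  measurable_range_function mu K ->
  exists F : nat -> dual -> l2, (forall n, measurable_fun setT (F n)) /\
    [/\ forall n chi, rnorm (F n chi) <= 1 &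
     {ae mu, forall chi, forall n, F n chi = P K chi (delta (e n))}].
Proof.
move=> [sK mK].
have /choice[N NP] : forall nj : nat * nat, exists N, [/\ measurable N, mu N =
  0%E &
    forall N', measurable N' -> N `<=` N' -> measurable_complex (fun chi =>
      (\1_(~` N') chi)%:C * l2_dot (P K chi (delta (e nj.1)))
        (delta (e nj.2)))].
  by move=> nj; exact: (mu_measurable_restrict (mK _ _)).
pose M := \bigcup_nj N nj.
have mM : measurable M.
  apply: countable_bigcupT_measurable => [|nj]; first exact: countableP.
  by have [] := NP nj.
have muM : mu.-negligible M.
  rewrite /M (_ : \bigcup_nj N nj =
    \bigcup_n N (odflt (0%N, 0%N) (unpickle n))); last first.
    apply/seteqP; split=> [t [nj _ Nt]|t [n _ Nt]];
      last by exists (odflt (0%N, 0%N) (unpickle n)).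
    by exists (pickle nj); rewrite // pickleK.
  apply: negligible_bigcup => n;
    have [mN muN _] := NP (odflt (0%N, 0%N) (unpickle n)).
  exact/negligibleP.
exists (fun n chi => (\1_(~` M) chi)%:C *: P K chi (delta (e n))); split;
  last split.
- move=> n; apply: (measurable_l2P e_bij) => i; have [g eg ge] := e_bij.
  have [_ _ /(_ M mM)] := NP (n, g i).
  under eq_fun do rewrite /= ge (l2_dot_delta e_bij).
  by apply; exact: bigcup_sup.
- move=> n chi; rewrite rnormZ normc_real indicE.
  have h : rnorm (P K chi (delta (e n))) <= 1.
    by rewrite (le_trans (orth_proj_le e_bij _ (sK chi)))// rnorm_delta.
  case: (_ \in _); rewrite /= ?normr1 ?mul1r//.
  by rewrite normr0 mul0r ler01.
- apply: negligibleS muM => chi /= nh; apply: contrapT => nM; apply: nh => n.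
  by rewrite indicE mem_set// scale1r.
Qed.

(** The projection is a linear contraction that fixes [x], so it maps combinations of the [delta]
    close to [x] to combinations of their projections at least as close. *)
Lemma sub_closed_span_orth_proj (K : dual -> set l2) chi :
  closed_subspace (K chi) ->
  K chi `<=` closed_span (range (fun n => P K chi (delta (e n)))).
Proof.
move=> sK x Kx.
have sM := closed_span_subspace (range (fun n => P K chi (delta (e n)))).
have qE s : P K chi (qcomb (delta \o e) s) =
  qcomb (fun n => P K chi (delta (e n))) s.
  elim: s => [|q s IH]; rewrite /qcomb ?big_nil ?big_cons.
    by rewrite (orth_proj_id e_bij)//; case: sK.
  by rewrite (orth_proj_linear e_bij _ _ _ sK) IH.
have /closure_rnormP dx : closure (range (qcomb (delta \o e))) x.
  by rewrite -closed_span_range; exact: delta_dense.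
rewrite closed_span_range; apply/closure_rnormP => eps /dx[_ [s _ <-] xs].
exists (qcomb (fun n => P K chi (delta (e n))) s); first by exists s.
apply: le_lt_trans xs.
have -> : x - qcomb (fun n => P K chi (delta (e n))) s =
  P K chi (x - qcomb (delta \o e) s).
  have := orth_proj_linear e_bij (-1) (qcomb (delta \o e) s) x sK.
  rewrite qE (orth_proj_id e_bij sK Kx) !scaleN1r => h.
  by rewrite [LHS]addrC -h; congr (orth_proj _ _ _); rewrite addrC.
exact: (orth_proj_le e_bij _ sK).
Qed.

End RangeFunctions.

(** * The correspondence between invariant subspaces and range functions *)

Section Correspondence.
Context {R : realType} {Gamma : zmodType} (e : nat -> Gamma)
  (e_bij : bijective e).
Local Notation C := R[i].
Local Notation dual := (dual R Gamma).
Local Notation l2 := (l2 R Gamma).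
Context (mu : {finite_measure set dual -> \bar R}) (sigma : nat -> set dual).
Context (H : completeNormedModType C) (pi : Gamma -> {linear H -> H}).
Context (p : set dual -> {linear H -> H}) (T : H -> dual -> l2).
Context (TP : spectral_data mu e sigma pi p T).
Implicit Types (V : set H) (v : nat -> H).

Definition span_range v chi : set l2 :=
  closed_span (range (fun n => T (v n) chi)).

Lemma span_range_range_function v : range_function (span_range v).
Proof. by move=> chi; exact: closed_span_subspace. Qed.

Lemma span_range_measurable v : measurable_range_function mu (span_range v).
Proof.
split; first exact: span_range_range_function.
move=> a b; apply: measurable_complex_mu.
apply: (measurable_orth_proj_dot e_bij (v := fun n => T (v n))) => n.
exact: (measurable_T TP).
Qed.

(** Norm approximation by the [v n] gives pointwise approximation almost everywhere. Conversely the
    rational combinations [w m] stay in [V], and outside one null set their values are dense in the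
    span at [chi], which is the situation of [invariant_ae_closure]. *)
Lemma span_range_section V v : invariant_subspace pi V -> (forall n, V (v n)) ->
  V `<=` closure (range v) -> V = section_space mu T (span_range v).
Proof.
move=> V_inv Vv vV; have [sV _] := V_inv; apply/seteqP; split=> f.
  move=> /vV /closure_rnormP fv.
  apply: (section_space_approx e_bij TP (span_range_range_function v) (y := v)).
    by move=> n; apply: aeW => chi; apply: sub_closed_span; exists n.
  by move=> eps /fv[_ [n _ <-] nP]; exists n.
pose w m := qcomb v (odflt [::] (unpickle m)).
have Vw m : V (w m).
  apply: (closed_subspace_sum _ _ sV) => q; exact: (closed_subspaceZ _ sV).
move=> fJ; apply: (invariant_ae_closure e_bij TP V_inv Vw).
have := ae_foralln (fun m => T_qcomb TP v (odflt [::] (unpickle m))).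
apply: filterS2 fJ => chi; rewrite /span_range closed_span_range =>
  /closure_rnormP fJ wE.
apply/closure_rnormP => eps /fJ[_ [s _ <-] sP].
exists (T (w (pickle s)) chi); first by exists (pickle s).
by rewrite /w wE pickleK.
Qed.

Lemma ae_countable (A : set H) (Q : H -> dual -> Prop) : countable A ->
  (forall f, A f -> {ae mu, forall chi, Q f chi}) ->
  {ae mu, forall chi, forall f, A f -> Q f chi}.
Proof.
move=> cA AQ; have [a aP] := countable_sub_range 0 cA.
(* The sequence [a] covers [A] but may leave it, hence the guard [A (a n)]. *)
have := @ae_foralln _ _ _ mu (fun n chi => A (a n) -> Q (a n) chi).
move=> h; apply: filterS (h _) => [chi aQ f Af|n].
  by have [n _ an] := aP _ Af; rewrite -an; apply: aQ; rewrite an.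
by have [Aan|nA] := pselect (A (a n)); [apply: filterS (AQ _ Aan)|exact: aeW].
Qed.

(** The sections of the range function spanned by [A] form a closed invariant subspace containing
    [A], so they contain all that [A] generates. *)
Lemma sub_section_span V (A : set H) : invariant_subspace pi V ->
  V = closed_span [set pi g f | g in setT & f in A] ->
  forall f, V f ->
  section_space mu T (fun chi => closed_span [set T h chi | h in A]) f.
Proof.
move=> V_inv VA f; rewrite VA; apply: closed_span_min.
  by apply: (section_space_subspace e_bij TP) => chi;
    exact: closed_span_subspace.
have [_ sinv] := section_space_invariant e_bij TP
  (fun chi => closed_span_subspace [set T h chi | h in A]).
move=> _ [g _ [h Ah <-]]; apply: sinv; apply: aeW => chi.
by apply: sub_closed_span; exists h.
Qed.

(** Each inclusion is tested on countably many generators: the [T f chi] with [f] in [A] on one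
    side, the [T (v n) chi] on the other. *)
Lemma span_range_unique V v (A : set H) : invariant_subspace pi V ->
  (forall x, pi 0 x = x) -> (forall n, V (v n)) -> V `<=` closure (range v) ->
  countable A ->
  V = closed_span [set pi g f | g in setT & f in A] ->
  {ae mu, forall chi, span_range v chi = closed_span [set T f chi | f in A]}.
Proof.
move=> V_inv pi0 Vv vV cA VA.
have VE := span_range_section V_inv Vv vV.
have AV f : A f -> V f.
  (* Translation by the neutral element puts [A] itself inside [V]. *)
  by move=> Af; rewrite VA; apply: sub_closed_span; exists 0 => //; exists f.
have h1 : {ae mu, forall chi, forall f, A f -> span_range v chi (T f chi)}.
  by apply: ae_countable => // f /AV; rewrite {1}VE.
have h2 := ae_foralln (fun n => sub_section_span V_inv VA (Vv n)).
apply: filterS2 h1 h2 => chi h1 h2; apply/seteqP; split.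
  apply: closed_span_min; first exact: closed_span_subspace.
  by move=> _ [n _ <-]; exact: h2.
apply: closed_span_min; first exact: closed_span_subspace.
by move=> _ [f Af <-]; exact: h1.
Qed.

(** Lying in the fibres, the sections [F n] of [K] are attained by vectors [f n]. These are sections
    of [K], hence of [span_range v], since both range functions define the same subspace; and the
    [F n] span [K chi] at almost every [chi]. *)
Lemma span_range_onto (K : dual -> set l2) v : measurable_range_function mu K ->
  {ae mu, forall chi, K chi `<=` fibre e sigma chi} ->
  (forall n, section_space mu T K (v n)) ->
  section_space mu T K `<=` closure (range v) ->
  {ae mu, forall chi, span_range v chi = K chi}.
Proof.
move=> mK Kfib Kv vK; have [sK _] := mK.
have K_inv := section_space_invariant e_bij TP sK.
have KE := span_range_section K_inv Kv vK.
have [F [mF [F1 FE]]] := range_function_sections e_bij mK.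
have FK : {ae mu, forall chi, forall n, K chi (F n chi)}.
  apply: filterS FE => chi FE n; rewrite FE.
  exact: (orth_proj_in e_bij _ (sK chi)).
have /choice[f fE] : forall n, exists f, {ae mu, forall chi, T f chi = F n chi}.
  move=> n; apply: (spectral_data_surj TP); split; last first.
    by apply: filterS2 FK Kfib => chi FK Kfib; exact: Kfib.
  split=> //; apply: (@le_lt_trans _ _ (\int[mu]_(chi in setT) (1 : R)%:E)%E).
    apply: ge0_le_integral => //.
    - by move=> chi _; rewrite lee_fin sqr_ge0.
    - exact: measurable_rnorm_sqr.
    - by move=> chi _; rewrite lee_fin expr_le1// rnorm_ge0.
  rewrite integral_cst//= mul1e ltey_eq.
  by rewrite fin_num_measure.
have fK n : section_space mu T (span_range v) (f n).
  rewrite -KE; apply: filterS2 FK (fE n) => chi FK ->; exact: FK.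
have h1 : {ae mu, forall chi, forall n, span_range v chi (F n chi)}.
  by apply: filterS2 (ae_foralln fK) (ae_foralln fE) => chi fK' fE' n;
    rewrite -fE'.
apply: filterS3 h1 FE (ae_foralln Kv) => chi h1 FE' Kv'; apply/seteqP; split.
  by apply: closed_span_min; [exact: sK|move=> _ [n _ <-]; exact: Kv'].
apply: subset_trans (sub_closed_span_orth_proj e_bij (sK chi)) _.
apply: closed_span_min; first exact: closed_span_subspace.
by move=> _ [n _ <-]; rewrite -FE'.
Qed.

End Correspondence.

(** One-to-one is rendered as injectivity together with surjectivity. The values [T f chi] lie in
    the fibre almost everywhere, so sections can recover only the part of [K chi] inside it; this is
    why [K] is bounded by [fibre]. *)
Theorem theorem4p6 (R : realType)
  (G : topologicalZmodType) (S : zmodClosed G)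
  (G_hausdorff : hausdorff_space G)
  (G_locally_compact : locally_compact [set: G])
  (G_second_countable : @second_countable G)
  (S_closed : closed [set` S])
  (S_countable : countable [set` S])
  (S_discrete : isolated [set` S] = [set` S])
  (alpha : {additive subgroup S -> subgroup S})
  (alpha_inj : injective alpha)
  (N : nat) (N_gt1 : (1 < N)%N)
  (alpha_index :
    ([set [set g + alpha h | h in [set: subgroup S]]
       | g in [set: subgroup S]] #= `I_N)%card)
  (lambda : probability (dual R (subgroup S)) R)
  (lambda_haar : is_haar lambda)
  (alpha_ergodic : ergodic lambda (dual_endo alpha))
  (H : completeNormedModType R[i]) (dot : {dot H for @Num.conj R[i]})
  (dotE : forall x : H, dot x x = `|x| ^+ 2)
  (H_separable : separable H)
  (pi : subgroup S -> {linear H -> H})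
  (pi_unitary : unitary_rep dot pi)
  (p : set (dual R (subgroup S)) -> {linear H -> H})
  (pP : spectral_measure_of dot pi p)
  (mu : {finite_measure set (dual R (subgroup S)) -> \bar R})
  (e : nat -> subgroup S) (e_bij : bijective e)
  (sigma : nat -> set (dual R (subgroup S)))
  (T : H -> dual R (subgroup S) -> l2 R (subgroup S))
  (T_spectral : spectral_data mu e sigma pi p T)
  (mu_lambda : mu `<< lambda)
  (mu_restr : forall E, measurable E -> mu E = lambda (E `&` sigma 0%N)) :
  exists J : set H -> dual R (subgroup S) -> set (l2 R (subgroup S)),
    [/\ forall V, invariant_subspace pi V ->
          measurable_range_function mu (J V) /\
          V = [set f | {ae mu, forall chi, J V chi (T f chi)}],
        (forall V W, invariant_subspace pi V -> invariant_subspace pi W ->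
          {ae mu, forall chi, J V chi = J W chi} -> V = W) /\
        (forall K, measurable_range_function mu K ->
          {ae mu, forall chi, K chi `<=` fibre e sigma chi} ->
          exists2 V, invariant_subspace pi V &
            {ae mu, forall chi, J V chi = K chi}),
        forall V, invariant_subspace pi V ->
          exists2 A : set H, countable A &
            V = closed_span [set pi g f | g in setT & f in A] &
        forall V, invariant_subspace pi V ->
          forall A : set H, countable A ->
            V = closed_span [set pi g f | g in setT & f in A] ->
            {ae mu, forall chi, J V chi = closed_span [set T f chi | f in A]}].
Proof.
have [pi0 _ _] := pi_unitary.
have /choice[v vP] : forall V : set H, exists v : nat ->
  H, invariant_subspace pi V ->
    (forall n, V (v n)) /\ V `<=` closure (range v).
  (* [J] is a total function, so a sequence is also chosen when [V] is not invariant; it is then the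
     constant 0. *)
  move=> V; have [[[V0 VD cV] Vi]|nV] := pselect (invariant_subspace pi V);
    last by exists (fun=> 0).
  by have [v vP] := exists_dense_seq H_separable V0; exists v.
have VE V : invariant_subspace pi V ->
  V = section_space mu T (span_range T (v V)).
  by move=> V_inv; have [Vv vV] := vP V V_inv;
    exact: (span_range_section e_bij T_spectral V_inv).
exists (fun V => span_range T (v V)); split.
- by move=> V V_inv; split;
    [exact: (span_range_measurable e_bij T_spectral)|exact: VE].
- split=> [V W V_inv W_inv VW|K mK Kfib].
    rewrite (VE V V_inv) (VE W W_inv); apply/seteqP; split => f.
      by apply: filterS2 VW => chi ->.
    by apply: filterS2 VW => chi ->.
  have K_inv := section_space_invariant e_bij T_spectral (mK.1).
  exists (section_space mu T K) => //; have [Kv vK] := vP _ K_inv.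
  exact: (span_range_onto e_bij T_spectral mK Kfib Kv vK).
- move=> V V_inv; have [Vv vV] := vP V V_inv; have [sV Vi] := V_inv.
  exists (range (v V)); first exact: card_image_le.
  apply/seteqP; split.
    (* The dense sequence approximates [f] without translates, so the neutral element of the group
       suffices. *)
    move=> f /vV; apply: closureS => _ [n _ <-]; apply: sub_lin_span.
    by exists 0 => //; exists (v V n); [exists n|exact: pi0].
  apply: closed_span_min => // _ [g _ [_ [n _ <-] <-]]; exact: Vi.
- move=> V V_inv A cA VA; have [Vv vV] := vP V V_inv.
  exact: (span_range_unique e_bij T_spectral V_inv pi0 Vv vV cA VA).
Qed.
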